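(* Let $f:L^2(0,T)\to\mathbb{R}$ be smooth (Fréchet differentiable), not necessarily convex. Let $\bar u\in\mathrm{BV}(0,T)$ be a minimizer of $J(u)=f(u)+\mathrm{TGV}(u)$ over $\mathrm{BV}(0,T)$ and let $\bar w\in\mathrm{BV}(0,T)$ be such that $\mathrm{TGV}(\bar u)=\alpha\|D\bar u-\bar w\|_M+\beta\|D\bar w\|_M$. Set $\bar p(x)=\int_0^x\nabla f(\bar u)(s)\,ds$ and $\bar P(x)=-\int_0^x\bar p(s)\,ds$, and assume that there are finite sets $\{\bar x^S_j\}_{j=1}^{N_S}$, $\{\bar x^K_j\}_{j=1}^{N_K}$ in $(0,T)$, $N_S,N_K\ge0$, with $$\{x\in(0,T)\,|\,\bar p(x)=\alpha\text{ or }\bar p(x)=-\alpha\}=\{\bar x_j^S\}_{j=1}^{N_S},\qquad\{x\in(0,T)\,|\,\bar P(x)=\beta\text{ or }\bar P(x)=-\beta\}=\{\bar x_j^K\}_{j=1}^{N_K}.$$ Put $\bar\sigma_j^S=\bar p(\bar x_j^S)/\alpha$ for $j=1,\dots,N_S$ and $\bar\sigma_j^K=\bar P(\bar x_j^K)/\beta$ for $j=1,\dots,N_K$. Then $$\bar u(x)=\frac1\alpha\sum_{j=1}^{N_S}\bar\sigma_j^S\bar\lambda_j^SS_{\bar x_j^S}(x)+\frac1\beta\sum_{j=1}^{N_K}\bar\sigma_j^K\bar\lambda_j^KK_{\bar x_j^K}(x)+\bar ax+\bar b,$$ where $(\bar\lambda^S,\bar\lambda^K,\bar a,\bar b)$ is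 a solution to $$\min_{\substack{\lambda^S\in\mathbb{R}_+^{N_S},\ \lambda^K\in\mathbb{R}_+^{N_K}\\ a,b\in\mathbb{R}}}\left[f\big(u(\lambda^S,\lambda^K,a,b)\big)+\sum_{j=1}^{N_S}\lambda_j^S+\sum_{j=1}^{N_K}\lambda_j^K\right]$$ subject to $$u(\lambda^S,\lambda^K,a,b)=\frac1\alpha\sum_{j=1}^{N_S}\bar\sigma_j^S\lambda_j^SS_{\bar x_j^S}+\frac1\beta\sum_{j=1}^{N_K}\bar\sigma_j^K\lambda_j^KK_{\bar x_j^K}+ax+b.$$ Moreover, $$\bar w=\frac1\beta\sum_{j=1}^{N_K}\bar\sigma_j^K\bar\lambda_j^K\,S_{\bar x_j^K}+\bar a\quad\text{and}\quad\mathrm{TGV}(\bar u)=\sum_{j=1}^{N_S}\bar\lambda_j^S+\sum_{j=1}^{N_K}\bar\lambda_j^K.$$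
   Context: $T>0$ and $\alpha,\beta>0$ are fixed. $C_0(0,T)$ is the space of continuous functions on $(0,T)$ vanishing at the boundary, with uniform norm $\|\cdot\|_C$; $M(0,T)=C_0(0,T)^*$ is the space of Radon measures with dual norm $\|\cdot\|_M$. $\mathrm{BV}(0,T)$ is the space of $u\in L^1(0,T)$ with distributional derivative $Du\in M(0,T)$. For $u\in\mathrm{BV}(0,T)$, $$\mathrm{TGV}(u)=\sup\left\{\int_0^T u\,v''\;\middle|\;v\in C_c^\infty(0,T),\ \|v\|_C\le\alpha,\ \|v'\|_C\le\beta\right\}=\inf_{w\in\mathrm{BV}(0,T)}\alpha\|Du-w\|_M+\beta\|Dw\|_M,$$ where $w$ is identified with the measure $w\,dx$. $\nabla f(u)\in L^2(0,T)$ is the Riesz representative of the Fréchet derivative of $f$ at $u$. $1_{(a,b)}$ is the characteristic function of $(a,b)$; $S_{x_0}=1_{(x_0,T)}$, and $K_{x_1}(x)=1_{(0,x_1)}(x)(x_1-x)$ if $x_1<T/2$, $K_{x_1}(x)=1_{(x_1,T)}(x)(x-x_1)$ if $x_1\ge T/2$. $\mathbb{R}_+=[0,\infty)$.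
   Formalization: The printed formula for w̄ fails when a kink point lies left of T/2; it is corrected by replacing S_{x_j} with K_{x_j}', i.e. S_{x_j} − 1 for x_j < T/2. TGV is taken as the inf expression, since the displayed sup has the bounds α and β interchanged. *)

(* Defs.v *)
(* MathComp-Analysis *)
From mathcomp Require Import all_boot all_order all_algebra.
From mathcomp Require Import all_classical all_reals all_analysis.

Set Implicit Arguments.
Unset Strict Implicit.
Unset Printing Implicit Defensive.
Import Order.TTheory GRing.Theory Num.Theory.
Import numFieldNormedType.Exports.

Local Open Scope classical_set_scope.
Local Open Scope ring_scope.

Section spaces.
Context {R : realType}.
Implicit Types (T : R) (u v w g phi : R -> R) (mu nu : (R -> R) -> R).

Local Notation leb := (@lebesgue_measure R).

(* Elements of L^p(0,T) are represented by functions on R, of which only the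
   values on ]0, T[ matter, up to a.e. equality there. *)
Definition ae_eq0T T u v := {ae leb, forall x, 0 < x < T -> u x = v x}.

Definition L1 T u := leb.-integrable `]0, T[ (EFin \o u).

Definition L2 T u := (u \_ `]0, T[) \in Lfun leb 2%:E.

Definition normL2 T u : R := fine ('N[leb]_2%:E[EFin \o (u \_ `]0, T[)]).

(* A function on L^2(0,T) does not depend on the representative; its values
   outside L^2(0,T) are irrelevant. *)
Definition well_defined_on_L2 T (f : (R -> R) -> R) :=
  forall u v, L2 T u -> L2 T v -> ae_eq0T T u v -> f u = f v.

(* A is a continuous linear form on the space E normed by N. *)
Definition bounded_linear_form (E : set (R -> R)) (N : (R -> R) -> R)
    (A : (R -> R) -> R) :=
  (forall (a : R) u v, E u -> E v ->
     A (fun x => a * u x + v x) = a * A u + A v) /\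
  (exists C : R, forall u, E u -> `|A u| <= C * N u).

Definition is_frechet_derivative T (f : (R -> R) -> R) u (A : (R -> R) -> R) :=
  [/\ L2 T u,
      bounded_linear_form (L2 T) (normL2 T) A &
      forall e : R, 0 < e -> exists2 d : R, 0 < d &
        forall h, L2 T h -> normL2 T h < d ->
          `|f (u \+ h) - f u - A h| <= e * normL2 T h].

Definition frechet_differentiable T (f : (R -> R) -> R) :=
  forall u, L2 T u -> exists A, is_frechet_derivative T f u A.

(* g is (a representative of) the Riesz representative of f'(u). *)
Definition is_gradient T (f : (R -> R) -> R) u g :=
  L2 T g /\ exists2 A, is_frechet_derivative T f u A &
    forall h, L2 T h -> A h = \int[leb]_(x in `]0, T[) (g x * h x).

(* C_0(0,T): each function is identified with its extension by zero to R,
   which is continuous exactly when the function vanishes at 0 and T. *)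
Definition C0 T : set (R -> R) :=
  [set phi | continuous phi /\ forall x, ~~ (0 < x < T) -> phi x = 0].

Definition normC T phi : R := sup [set `|phi x| | x in `]0, T[].

Definition test_function T : set (R -> R) :=
  [set phi | (forall n x, derivable (derive1n n phi) x 1) /\
     exists a b : R, [/\ 0 < a, b < T &
       forall x, ~~ (a <= x <= b) -> phi x = 0]].

(* M(0,T) = C_0(0,T)^* with its dual norm; a measure is the linear form on
   C_0(0,T) that it defines, and its values outside C_0(0,T) are irrelevant. *)
Definition Mspace T : set ((R -> R) -> R) := bounded_linear_form (C0 T) (normC T).

Definition normM T mu : R :=
  sup [set `|mu phi| | phi in [set phi | C0 T phi /\ normC T phi <= 1]].

(* the measure w dx *)
Definition density T w : (R -> R) -> R :=
  fun phi => \int[leb]_(x in `]0, T[) (w x * phi x).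

Definition is_distributional_derivative T u mu :=
  forall phi, test_function T phi ->
    mu phi = - \int[leb]_(x in `]0, T[) (u x * derive1 phi x).

(* BV(0,T) is contained in L^2(0,T), so that f u makes sense for u in BV(0,T)
   when f is a function on L^2(0,T). *)
Definition BV T : set (R -> R) :=
  [set u | L1 T u /\
     exists2 mu, Mspace T mu & is_distributional_derivative T u mu].

(* Du for u in BV(0,T); the test functions being dense in C_0(0,T), its values
   on C_0(0,T) do not depend on the choice made by [xget]. *)
Definition Dmeas T u : (R -> R) -> R :=
  xget (fun=> 0) [set mu | Mspace T mu /\ is_distributional_derivative T u mu].

Definition TGV_functional T (alpha beta : R) u w : R :=
  alpha * normM T (Dmeas T u \- density T w) + beta * normM T (Dmeas T w).

Definition TGV T (alpha beta : R) u : R :=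
  inf [set TGV_functional T alpha beta u w | w in BV T].

Definition pbar g (x : R) : R := \int[leb]_(s in `]0, x[) g s.

Definition Pbar g (x : R) : R := - \int[leb]_(s in `]0, x[) pbar g s.

Definition Sfun T (x0 : R) : R -> R := \1_(`]x0, T[).

Definition Kfun T (x1 : R) : R -> R := fun x =>
  if x1 < T / 2 then \1_(`]0, x1[) x * (x1 - x)
  else \1_(`]x1, T[) x * (x - x1).

(* K_{x1}' almost everywhere on ]0, T[: this is S_{x1} if x1 >= T/2, but
   S_{x1} - 1 = - 1_(0, x1) if x1 < T/2. *)
Definition dKfun T (x1 : R) : R -> R := fun x =>
  if x1 < T / 2 then Sfun T x1 x - 1 else Sfun T x1 x.

Definition u_param T (alpha beta : R) (NS NK : nat)
    (xS sS : 'I_NS -> R) (xK sK : 'I_NK -> R)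
    (lS : 'I_NS -> R) (lK : 'I_NK -> R) (a b : R) : R -> R := fun x =>
  alpha^-1 * (\sum_(j < NS) sS j * lS j * Sfun T (xS j) x) +
  beta^-1 * (\sum_(j < NK) sK j * lK j * Kfun T (xK j) x) + a * x + b.

(* the density of the absolutely continuous part of D(u_param) *)
Definition w_param T (beta : R) (NK : nat)
    (xK sK : 'I_NK -> R) (lK : 'I_NK -> R) (a : R) : R -> R := fun x =>
  beta^-1 * (\sum_(j < NK) sK j * lK j * dKfun T (xK j) x) + a.

End spaces.

(* Main.v *)
From mathcomp Require Import measurable_realfun.
Require Import Defs.
From mathcomp Require Import all_boot all_order all_algebra.
From mathcomp Require Import all_classical all_reals all_analysis.
From mathcomp Require Import ring lra.
Set Implicit Arguments.
Unset Strict Implicit.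
Unset Printing Implicit Defensive.
Import Order.TTheory GRing.Theory Num.Theory.
Import numFieldNormedType.Exports.
Local Open Scope classical_set_scope.
Local Open Scope ring_scope.

(** Write [Du] for the derivative of [ubar].  Perturbing the
    pair [(ubar, wbar)] by [(t v, t w)] and letting [t] tend to [0] gives
    [|int g v| <= alpha |Dv - w|_M + beta |Dw|_M] for every pair, while
    the direction [(ubar, wbar)] gives [int g ubar = - TGV ubar].  The
    pairs [(1, 0)], [(x, 1)], [(S, 0)], [(K, K')] show that [pbar] and [Pbar]
    lie in [C_0] and are bounded by [alpha] and [beta].  Integrating
    [int g ubar] by parts twice then yields
    [<Du - wbar, pbar> + <Dwbar, Pbar> = alpha |Du - wbar|_M + beta |Dwbar|_M],
    so that each pairing attains its maximum.  A form [m] with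
    [m p = |p|_C |m|_M] vanishes on every function dominated by a multiple of
    [|p|_C - |p|], hence on every function vanishing where [|p|] is maximal:
    it is a combination of Dirac masses there, and no representation theorem
    for [C_0^*] is needed.  Finally, a function in [L^1] with zero derivative
    is constant. *)

(** * Smooth compactly supported functions *)

(** The derivative of [ubar] is known on test functions only, while [pbar] is the primitive of a
    mere L^2 function. Both integrations by parts therefore rest on an extension of the defining
    identity, obtained by a monotone class argument instead of mollification. The same extension
    shows that a form on C_0 is determined by its values on test functions, so that [Dmeas] does not
    depend on a choice.

    The minus sign in [Pbar] makes <Dwbar, Pbar> the integral of wbar pbar. This cancels the density
    part of <Du - wbar, pbar>, and the two pairings add up to - int g ubar = TGV ubar.

    Optimality of the weights is a comparison: admissible weights satisfy TGV(u(lambda)) <= sum of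
    the lambda, with w(lambda) as competitor in the infimum, and equality holds for the weights
    extracted from [ubar]. Minimality of [ubar] for J thus passes to the finite-dimensional
    problem. *)

Section smooth.
Context {R : realType}.
Implicit Types (f g : R -> R) (n : nat) (x : R) (P : {poly R}).

(** Peels off the first derivative instead of the last one, so that inductions generalized over [f]
    go through products and affine substitutions. *)
Fixpoint derivable_upto n f : Prop :=
  match n with
  | 0 => forall x, derivable f x 1
  | n'.+1 => (forall x, derivable f x 1) /\ derivable_upto n' (derive1 f)
  end.

Lemma derivable_uptoP f :
  (forall n, derivable_upto n f) <-> (forall n x, derivable (derive1n n f) x 1).
Proof.
split=> [+ n|H n]; last first.
  elim: n f H => [|n ih] f H; first exact: (H 0%N).
  split; first exact: (H 0%N).
  by apply: ih => k x; rewrite -derive1Sn; exact: H.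
elim: n f => [|n ih] f H x; first exact: (H 0%N).
by rewrite derive1Sn; apply: ih => k; case: (H k.+1).
Qed.

Lemma derivable_uptoS n f : derivable_upto n.+1 f -> derivable_upto n f.
Proof. by elim: n f => [|n ih] f [] // df [d1 d2]; split => //; apply: ih. Qed.

Lemma derivable_uptoD n f g : derivable_upto n f -> derivable_upto n g ->
  derivable_upto n (fun x => f x + g x).
Proof.
elim: n f g => [|n ih] f g /= hf hg.
  by move=> x; apply: derivableD.
case: hf hg => df f' [dg g']; split.
  by move=> x; apply: derivableD.
rewrite (_ : derive1 (fun x => f x + g x) = fun x => derive1 f x + derive1 g x); first exact: ih.
by apply/funext => x; rewrite !derive1E deriveD.
Qed.

Lemma derivable_uptoM n f g : derivable_upto n f -> derivable_upto n g ->
  derivable_upto n (fun x => f x * g x).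
Proof.
elim: n f g => [|n ih] f g hf hg.
  by move=> x; apply: derivableM; [exact: hf|exact: hg].
case: (hf) (hg) => df f' [dg g']; split.
  by move=> x; apply: derivableM.
rewrite (_ : derive1 (fun x => f x * g x) = fun x => f x * derive1 g x + g x * derive1 f x).
  by apply: derivable_uptoD; apply: ih => //; exact: derivable_uptoS.
by apply/funext => x; rewrite !derive1E deriveM.
Qed.

Lemma derivable_upto_cst n (c : R) : derivable_upto n (fun=> c).
Proof.
elim: n c => [|n ih] c /=; first by move=> x; exact: derivable_cst.
split; first by move=> x; exact: derivable_cst.
by rewrite (_ : derive1 (fun=> c) = fun=> 0)//; apply/funext => x; rewrite derive1_cst.
Qed.

Lemma derivable_upto_affine n f (a b : R) : derivable_upto n f ->
  derivable_upto n (fun x => f (a * x + b)).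
Proof.
have daff x : is_derive x 1 (fun x => a * x + b) a.
  by apply: is_derive_eq; rewrite addr0 /GRing.scale/= mulr1.
have dcomp g x : (forall y, derivable g y 1) ->
    is_derive x 1 (fun x => g (a * x + b)) (derive1 g (a * x + b) * a).
  move=> dg; rewrite derive1E.
  by apply: (@is_derive1_comp _ g (fun x => a * x + b)) => //; exact/derivableP.
elim: n f => [|n ih] f hf.
  by move=> x; have [] := dcomp f x hf.
case: hf => df f'; split; first by move=> x; have [] := dcomp f x df.
rewrite (_ : derive1 _ = fun x => derive1 f (a * x + b) * a).
  by apply: derivable_uptoM; [exact: ih|exact: derivable_upto_cst].
by apply/funext => x; rewrite derive1E; have [_ ->] := dcomp f x df.
Qed.

(* The functions [P(1/x) exp(-1/x)], extended by zero, are stable under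
   differentiation, which makes them smooth at zero as well. *)
Definition flat P x : R := if 0 < x then P.[x^-1] * expR (- x^-1) else 0.

Lemma exprn_expR_bounded k : exists C : R, forall y, 0 < y -> y ^+ k * expR (- y) <= C.
Proof.
case: k => [|k].
  by exists 1 => y y0; rewrite expr0 mul1r -expR0 ler_expR; lra.
(* With N = k + 1, exp(y/N) >= 1 + y/N > y/N; the power N of this gives y^N exp(-y) <= N^N. *)
exists (k.+1%:R ^+ k.+1) => y y0.
have k0 : 0 < k.+1%:R :> R by rewrite ltr0n.
have -> : - y = (- (y / k.+1%:R)) *+ k.+1.
  by rewrite -mulr_natr; field; rewrite gt_eqF.
rewrite -[_ *+ _]mulr_natr mulrC expRM_natr -exprMn.
have e0 := expR_gt0 (y / k.+1%:R).
apply: lerXn2r; rewrite ?nnegrE ?mulr_ge0 ?expR_ge0 ?ltW//.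
rewrite expRN mulrC ltr_pdivrMr// -ltr_pdivrMl// mulrC.
by rewrite (lt_le_trans _ (expR_ge1Dx _))// ltrDr.
Qed.

Lemma poly_expR_bounded P : exists C : R, forall y, 0 < y -> `|P.[y] * expR (- y)| <= C.
Proof.
have /choice[C HC] := exprn_expR_bounded.
exists (\sum_(i < size P) `|P`_i| * C i) => y y0.
rewrite horner_coef mulr_suml (le_trans (ler_norm_sum _ _ _))//.
apply: ler_sum => i _; rewrite -mulrA normrM ler_wpM2l//.
by rewrite ger0_norm ?HC// mulr_ge0 ?expR_ge0// exprn_ge0// ltW.
Qed.

(** For x > 0 put y = 1/x, so that dy/dx = - y^2: the product rule turns P(y) exp(-y) into y^2 (P -
    P')(y) exp(-y). *)
Lemma is_derive_flat P x : is_derive x 1 (flat P) (flat ('X^2 * (P - P^`())) x).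
Proof.
have [x0|x0|->] := ltgtP x 0.
- rewrite {2}/flat ltNge ltW//=.
  apply: (@near_eq_is_derive _ _ _ (cst 0)).
    near=> y; rewrite /flat ifN// -leNgt ltW//; near: y; exact: lt_nbhsl.
- rewrite {2}/flat x0.
  apply: (@near_eq_is_derive _ _ _ (fun y : R => P.[y^-1] * expR (- y^-1) : R)).
    near=> y; rewrite /flat ifT//; near: y; exact: lt_nbhsr.
  have xN0 : x != 0 by rewrite gt_eqF.
  have dV : is_derive x 1 (fun y : R => y^-1) (- x ^- 2).
    apply: is_derive_eq; first exact: is_deriveV.
    by rewrite /GRing.scale/= mulr1.
  have dP : is_derive x 1 (fun y => P.[y^-1]) (P^`().[x^-1] * (- x ^- 2)).
    apply: (@is_derive1_comp _ (fun y => P.[y]) (fun y => y^-1)) => //.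
    exact: is_derive_poly.
  have dN : is_derive x 1 (fun y : R => - y^-1) (x ^- 2).
    by rewrite -[x ^- 2]opprK; exact: is_deriveN.
  have dE : is_derive x 1 (fun y => expR (- y^-1)) (expR (- x^-1) * x ^- 2).
    exact: (@is_derive1_comp _ expR (fun y : R => - y^-1)).
  rewrite -[X in is_derive _ _ X _]/((fun y : R => P.[y^-1]) * (fun y : R => expR (- y^-1))).
  apply: is_derive_eq.
  rewrite /GRing.scale/= hornerM hornerXn hornerD hornerN -exprVn.
  have ring_id (p q r s : R) : p * (r * s ^+ 2) + r * (q * - s ^+ 2) = s ^+ 2 * (p - q) * r by ring.
  exact: ring_id.
- rewrite {2}/flat ltxx.
  (* The two extra powers of 1/h leave a factor h in the difference quotient at 0: flat P h / h = h
     (P X^2)(1/h) exp(-1/h), of order h. *)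
  have [C HC] := poly_expR_bounded (P * 'X^2).
  have H : (fun h : R => h^-1 *: (flat P (h *: 1 + 0) - flat P 0)) @ 0^' --> (0:R).
    apply/cvgr0Pnorm_le => e e0; near=> h.
    have hN0 : h != 0 by near: h; exact: nbhs_dnbhs_neq.
    rewrite addr0 /GRing.scale/= mulr1 {2}/flat ltxx subr0 /flat.
    case: ltP => h0; last by rewrite mulr0 normr0 ltW.
    have := HC h^-1; rewrite invr_gt0 => /(_ h0).
    rewrite hornerM hornerXn.
    rewrite (_ : h^-1 * _ = h * (P.[h^-1] * (h^-1) ^+ 2 * expR (- h^-1))); last by field.
    rewrite [in X in _ -> X]normrM => hC.
    apply: (@le_trans _ _ (`|h| * `|C|)).
      by rewrite ler_wpM2l// (le_trans hC)// ler_norm.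
    apply: (@le_trans _ _ (`|h| * (`|C| + 1))); first by rewrite ler_wpM2l//; lra.
    rewrite -ler_pdivlMr; last by rewrite ltr_wpDl.
    near: h; apply: dnbhs0_le; rewrite divr_gt0// ltr_wpDl//.
  by split; [apply/cvg_ex; exists 0; exact: H|exact/cvg_lim].
Unshelve. all: by end_near. Qed.

Lemma derivable_upto_flat n P : derivable_upto n (flat P).
Proof.
elim: n P => [|n ih] P; first by move=> x; have [] := is_derive_flat P x.
split; first by move=> x; have [] := is_derive_flat P x.
rewrite (_ : derive1 (flat P) = flat ('X^2 * (P - P^`()))); first exact: ih.
by apply/funext => x; rewrite derive1E; have [_ ->] := is_derive_flat P x.
Qed.

(** For n > 0 the shift by -1 confines the support to [a + 1/n, b - 1/n]. Inside ]a, b[ both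
    arguments tend to infinity, where [flat 1] tends to 1. *)
Definition smooth_bump (a b : R) n x : R :=
  flat 1 (n%:R * (x - a) - 1) * flat 1 (n%:R * (b - x) - 1).

Lemma flat1_ge0 x : 0 <= flat 1 x.
Proof. by rewrite /flat; case: ifP => // _; rewrite hornerC mul1r expR_ge0. Qed.

Lemma flat1_le1 x : flat 1 x <= 1.
Proof.
rewrite /flat; case: ifP => // x0; rewrite hornerC mul1r -expR0 ler_expR.
by rewrite oppr_le0 invr_ge0 ltW.
Qed.

Lemma smooth_bump_ge0 a b n x : 0 <= smooth_bump a b n x.
Proof. by rewrite mulr_ge0// flat1_ge0. Qed.

Lemma smooth_bump_le1 a b n x : smooth_bump a b n x <= 1.
Proof. by rewrite mulr_ile1// ?flat1_ge0 ?flat1_le1. Qed.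

Lemma smooth_bump_test_function (T a b : R) n : 0 <= a -> b <= T ->
  test_function T (smooth_bump a b n.+1).
Proof.
move=> a0 bT; split.
  apply/derivable_uptoP => k; apply: derivable_uptoM.
    rewrite (_ : (fun _ => _) = fun x => flat 1 (n.+1%:R * x + (- n.+1%:R * a - 1))).
      exact/derivable_upto_affine/derivable_upto_flat.
    by apply/funext => x; congr flat; ring.
  rewrite (_ : (fun _ => _) = fun x => flat 1 (- n.+1%:R * x + (n.+1%:R * b - 1))).
    exact/derivable_upto_affine/derivable_upto_flat.
  by apply/funext => x; congr flat; ring.
have n0 : 0 < n.+1%:R :> R by rewrite ltr0n.
have nv0 : 0 < n.+1%:R^-1 :> R by rewrite invr_gt0.
exists (a + n.+1%:R^-1), (b - n.+1%:R^-1); split.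
- by rewrite ltr_wpDl.
- by rewrite (lt_le_trans _ bT)// ltrBlDr ltrDl.
move=> x; rewrite negb_and -!ltNge => /orP[] h; rewrite /smooth_bump.
  rewrite {1}/flat ifN ?mul0r// -leNgt subr_le0 -ler_pdivlMl// mulr1 lerBlDl; exact: ltW.
rewrite mulrC {1}/flat ifN ?mul0r// -leNgt subr_le0 -ler_pdivlMl// mulr1 lerBlDl -lerBlDr;
    exact: ltW.
Qed.

Lemma cvg_flat1 c : 0 < c -> flat 1 (n.+1%:R * c - 1) @[n --> \oo] --> (1 : R).
Proof.
move=> c0; apply/cvgrPdist_le => e e0; near=> n.
(* This makes y = (n + 1) c - 1 at least 1/e, and 1 - exp(-1/y) <= 1/y <= e. *)
have H : (e^-1 + 1) / c <= n%:R by near: n; exact: nbhs_infty_ger.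
have {}H : e^-1 <= n.+1%:R * c - 1.
  rewrite lerBrDr -ler_pdivrMr// (le_trans H)// ler_nat//.
set y := _ - 1 in H *.
have y0 : 0 < y by rewrite (lt_le_trans _ H)// invr_gt0.
rewrite ger0_norm ?subr_ge0 ?flat1_le1// /flat y0 hornerC mul1r.
have := expR_ge1Dx (- y^-1).
have : y^-1 <= e by rewrite -[e]invrK lef_pV2// posrE ?invr_gt0.
move: (y^-1) (expR _) => p q; lra.
Unshelve. all: by end_near. Qed.

Lemma smooth_bump_out a b n x : ~~ (a < x < b) -> smooth_bump a b n x = 0.
Proof.
rewrite negb_and -!leNgt => /orP[] h; rewrite /smooth_bump.
  by rewrite {1}/flat ifN ?mul0r// -leNgt subr_le0 (@le_trans _ _ 0)// mulr_ge0_le0// subr_le0.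
by rewrite mulrC {1}/flat ifN ?mul0r// -leNgt subr_le0 (@le_trans _ _ 0)// mulr_ge0_le0// subr_le0.
Qed.

Lemma cvg_smooth_bump a b x : smooth_bump a b n.+1 x @[n --> \oo] --> (\1_(`]a, b[) x : R).
Proof.
have [/andP[ax xb]|axb] := boolP (a < x < b).
  rewrite indicE mem_set/= ?in_itv/= ?ax// -[1%:R]mulr1.
  by apply: cvgM; apply: cvg_flat1; rewrite subr_gt0.
rewrite indicE memNset/= ?in_itv/=; last exact/negP.
apply: (@cvg_trans _ ((0:R) @[n --> \oo])); last exact: cvg_cst.
by apply: near_eq_cvg; apply: nearW => n; rewrite smooth_bump_out.
Qed.

End smooth.

(** * Integrals over ]0, T[ and primitives *)

Section integrals.
Context {R : realType}.
Variable T : R.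
Hypothesis T0 : 0 < T.
Implicit Types (u v g h phi : R -> R).

Local Notation leb := (@lebesgue_measure R).
Local Notation D := (`]0, T[%classic : set (measurableTypeR R)).
Local Notation Int u := (Rintegral leb `]0, T[ u).

Let mD : measurable D. Proof. exact: measurable_itv. Qed.

Let lebD : (leb D < +oo)%E.
Proof. by rewrite lebesgue_measure_itv/=; case: ifP => _; rewrite ?EFinN -?EFinB ltry. Qed.

Lemma L1_measurable u : L1 T u -> measurable_fun D u.
Proof. by move=> /integrableP[/measurable_EFinP]. Qed.

Lemma L1_le u v : measurable_fun D u -> (forall x, D x -> `|u x| <= v x) ->
  L1 T v -> L1 T u.
Proof.
move=> mu uv; apply: le_integrable => //; first exact/measurable_EFinP.
by move=> x Dx; rewrite !abse_EFin lee_fin (le_trans (uv _ Dx))// ler_norm.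
Qed.

Lemma L1_eq u v : (forall x, D x -> u x = v x) -> L1 T u -> L1 T v.
Proof.
move=> uv; apply: eq_integrable => // x /[!inE] Dx.
by rewrite /= uv.
Qed.

Lemma L1D u v : L1 T u -> L1 T v -> L1 T (fun x => u x + v x).
Proof.
move=> iu iv; exact: (integrableD mD iu iv).
Qed.

Lemma L1Z (c : R) u : L1 T u -> L1 T (fun x => c * u x).
Proof.
move=> iu; exact: (integrableZl mD c iu).
Qed.

Lemma L1B u v : L1 T u -> L1 T v -> L1 T (fun x => u x - v x).
Proof.
move=> iu iv; exact: (integrableB mD iu iv).
Qed.

Lemma L1_abs u : L1 T u -> L1 T (fun x => `|u x|).
Proof. by move=> iu; exact: (integrable_norm iu). Qed.

Lemma L1_bounded u (C : R) : measurable_fun D u ->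
  (forall x, D x -> `|u x| <= C) -> L1 T u.
Proof.
move=> mu uC; apply: measurable_bounded_integrable => //.
by exists C; split; [exact: num_real|move=> M CM x /= Dx; rewrite (le_trans (uC _ Dx))// ltW].
Qed.

Lemma L1_cst (c : R) : L1 T (fun=> c).
Proof. by apply: (@L1_bounded _ `|c|). Qed.

Lemma L1M u h (C : R) : L1 T u -> measurable_fun D h ->
  (forall x, D x -> `|h x| <= C) -> L1 T (fun x => u x * h x).
Proof.
move=> iu mh hC; apply: (@L1_le _ (fun x => C * `|u x|)).
- by apply: measurable_funM => //; exact: L1_measurable.
- by move=> x Dx; rewrite normrM mulrC ler_wpM2r// hC.
- exact/L1Z/L1_abs.
Qed.

Lemma L1_indic (A : set (measurableTypeR R)) : measurable A -> L1 T (\1_A).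
Proof.
move=> mA; apply: (@L1_bounded _ 1).
  exact: measurable_indic.
by move=> x _; rewrite indicE; case: (_ \in _); rewrite ?normr1 ?normr0.
Qed.

Lemma eq_Int u v : (forall x, D x -> u x = v x) -> Int u = Int v.
Proof. by move=> uv; apply: eq_Rintegral => x /[!inE]; exact: uv. Qed.

Lemma IntD u v : L1 T u -> L1 T v -> Int (fun x => u x + v x) = Int u + Int v.
Proof. by move=> iu iv; rewrite RintegralD. Qed.

Lemma IntB u v : L1 T u -> L1 T v -> Int (fun x => u x - v x) = Int u - Int v.
Proof. by move=> iu iv; rewrite RintegralB. Qed.

Lemma IntZ (c : R) u : L1 T u -> Int (fun x => c * u x) = c * Int u.
Proof. by move=> iu; rewrite RintegralZl. Qed.

Lemma Int_cst (c : R) : Int (fun=> c) = c * T.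
Proof. by rewrite Rintegral_cst//= lebesgue_measure_itv/= lte_fin T0/= subr0. Qed.

Lemma le_Int u v : L1 T u -> L1 T v -> (forall x, D x -> u x <= v x) -> Int u <= Int v.
Proof. by move=> iu iv uv; exact: le_Rintegral. Qed.

Lemma Int_abs u : L1 T u -> `|Int u| <= Int (fun x => `|u x|).
Proof. by move=> iu; exact: le_normr_Rintegral. Qed.

Lemma Int_abs_ge0 u : 0 <= Int (fun x => `|u x|).
Proof. exact: Rintegral_ge0. Qed.

(** Convergence in L^1 rather than of the integrals, because the functional to be extended later is
    bounded by L^1 norms. *)
Lemma Int_dominated (h_ : nat -> R -> R) h v :
  (forall n, measurable_fun D (h_ n)) ->
  (forall x, D x -> h_ n x @[n --> \oo] --> h x) ->
  L1 T v -> (forall n x, D x -> `|h_ n x| <= v x) ->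
  L1 T h /\ Int (fun x => `|h_ n x - h x|) @[n --> \oo] --> (0 : R).
Proof.
move=> mh hh iv hv.
have mlim : measurable_fun D h by apply: (measurable_fun_cvg mh).
have [] := @dominated_convergence _ _ _ leb D mD (fun n => EFin \o h_ n) (EFin \o h) (EFin \o v).
- by move=> n; exact/measurable_EFinP.
- exact/measurable_EFinP.
- apply: aeW => x Dx; apply/fine_cvgP; split; first exact: nearW.
  exact: hh.
- exact: iv.
- by apply: aeW => x n Dx; rewrite /= lee_fin hv.
move=> ih c0 _; split; first exact: ih.
move/fine_cvgP : c0 => [_].
apply: cvg_trans; apply: near_eq_cvg; apply: nearW => n /=.
by rewrite /Rintegral; congr fine; apply: eq_integral => x _; rewrite /= -EFinB.
Qed.

Lemma Int_cvg (h_ : nat -> R -> R) h : (forall n, L1 T (h_ n)) -> L1 T h ->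
  Int (fun x => `|h_ n x - h x|) @[n --> \oo] --> (0 : R) ->
  Int (h_ n) @[n --> \oo] --> Int h.
Proof.
move=> ih_ ih H; apply/cvgrPdist_le => e e0; near=> n.
rewrite distrC -IntB//; apply: le_trans (Int_abs _) _; first exact: L1B.
rewrite -[leLHS]ger0_norm ?Int_abs_ge0// -[X in `|X|]subr0.
near: n; move/cvgrPdist_le : H => /(_ _ e0); apply: filterS => n.
by rewrite distrC.
Unshelve. all: by end_near. Qed.

(* Unlike [pbar], this stays constant outside ]0, T[, so that it lies in C_0 as soon
   as [g] has mean zero. *)
Definition prim (g : R -> R) (x : R) : R :=
  \int[leb]_(s in `]-oo, x]) ((g \_ D) s).

Lemma L1_restrict g : L1 T g -> leb.-integrable setT (EFin \o (g \_ D)).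
Proof. move=> ig; rewrite -restrict_EFin.
by rewrite -integrable_mkcond. Qed.

(** With a domain independent of [x], linearity and bounds for [prim] follow from those of the
    integral over ]0, T[. *)
Lemma primE g x : prim g x = Int (fun s => g s * \1_(`]-oo, x]) s).
Proof.
rewrite /prim -Rintegral_mkcondr [in RHS]Rintegral_mkcond Rintegral_mkcond.
apply: eq_Rintegral => s _; rewrite /patch indicE in_setI.
by case: (s \in `]-oo, x]%classic); case: (s \in D); rewrite /= ?mulr1 ?mulr0.
Qed.

Lemma L1_prim_integrand g x : L1 T g -> L1 T (fun s => g s * \1_(`]-oo, x]) s).
Proof.
move=> ig; apply: (@L1M g (\1_(`]-oo, x] : set (measurableTypeR R))) 1) => //.
by move=> s _; rewrite indicE; case: (_ \in _); rewrite ?normr1 ?normr0.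
Qed.

Lemma primD g h x : L1 T g -> L1 T h -> prim (fun s => g s + h s) x = prim g x + prim h x.
Proof.
move=> ig ih; rewrite !primE -IntD; [|exact: L1_prim_integrand..].
by apply: eq_Int => s _; rewrite mulrDl.
Qed.

Lemma primZ (c : R) g x : L1 T g -> prim (fun s => c * g s) x = c * prim g x.
Proof.
move=> ig; rewrite !primE -IntZ; last exact: L1_prim_integrand.
by apply: eq_Int => s _; rewrite mulrA.
Qed.

Lemma prim_abs g x : L1 T g -> `|prim g x| <= Int (fun s => `|g s|).
Proof.
move=> ig; rewrite primE; apply: le_trans (Int_abs _) _; first exact: L1_prim_integrand.
apply: le_Int; [exact/L1_abs/L1_prim_integrand|exact: L1_abs|].
by move=> s _; rewrite normrM ler_piMr// indicE; case: (_ \in _); rewrite ?normr1 ?normr0.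
Qed.

Lemma prim_left g x : (forall s, D s -> s <= x -> g s = 0) -> prim g x = 0.
Proof.
move=> g0; rewrite primE (@eq_Int _ (fun=> 0)); first by rewrite Int_cst mul0r.
move=> s Ds; rewrite indicE; case: (boolP (s \in _)); rewrite ?mulr0//.
by rewrite inE/= in_itv/= => sx; rewrite g0// mul0r.
Qed.

Lemma prim_right g x : (forall s, D s -> x < s -> g s = 0) -> prim g x = Int g.
Proof.
move=> g0; rewrite primE; apply: eq_Int => s Ds.
rewrite indicE; case: (boolP (s \in _)); rewrite ?mulr1//.
by rewrite notin_setE/= in_itv/= => /negP; rewrite -ltNge => sx; rewrite g0// mul0r.
Qed.

Lemma prim_pbar g x : 0 < x < T -> L1 T g -> prim g x = pbar g x.
Proof.
move=> /andP[x0 xT] ig; rewrite /pbar Rintegral_itv_bndo_bndc; last first.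
  by apply: integrableS ig => //; apply: subset_itvl; rewrite bnd_simp ltW.
rewrite /prim -Rintegral_mkcondr; congr Rintegral.
apply/seteqP; split=> s /=; rewrite !in_itv/=.
  by move=> [-> /andP[->]].
by move=> /andP[-> sx]; rewrite sx (le_lt_trans sx xT).
Qed.

(** Absolute continuity of the integral, on the interval between two points, whose measure is their
    distance. *)
Lemma continuous_prim g : L1 T g -> continuous (prim g).
Proof.
move=> /L1_restrict ig x; apply/cvgrPdist_le => e e0.
have [d [d0 Hd]] := integral_normr_continuous ig e0.
have H (y z : R) : y <= z -> z - y < d -> `|prim g z - prim g y| <= e.
  move=> yz zyd; rewrite /prim (@Rintegral_itvB _ (g \_ D) _ (BRight z)) ?bnd_simp//.
    apply: le_trans (le_normr_Rintegral _ _) _ => //.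
      exact: integrableS ig.
    apply/ltW/Hd => //=; rewrite lebesgue_measure_itv/=; case: ifP => _.
      by rewrite -EFinB lte_fin.
    by rewrite lte_fin.
  exact: integrableS ig.
near=> y.
have yd : `|x - y| < d by near: y; exists d.
have [xy|/ltW yx] := leP y x.
  by apply: H => //; rewrite (le_lt_trans _ yd)// ler_norm.
by rewrite distrC H// (le_lt_trans _ yd)// distrC ler_norm.
Unshelve. all: by end_near. Qed.


Lemma C0_prim g : L1 T g -> Int g = 0 -> C0 T (prim g).
Proof.
move=> ig g0; split; first exact: continuous_prim.
move=> x; rewrite negb_and -!leNgt => /orP[] xT.
  apply: prim_left => s; rewrite /= in_itv/= => /andP[s0 _] sx.
  by have := lt_le_trans s0 (le_trans sx xT); rewrite ltxx.
rewrite prim_right// => s; rewrite /= in_itv/= => /andP[_ sT] xs.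
by have := le_lt_trans xT (lt_trans xs sT); rewrite ltxx.
Qed.

Lemma test_function_continuous phi : test_function T phi -> continuous phi.
Proof.
by move=> [d _] x; apply: differentiable_continuous; apply/derivable1_diffP; exact: (d 0%N).
Qed.

Lemma test_function_derive1_continuous phi : test_function T phi -> continuous (derive1 phi).
Proof.
by move=> [d _] x; apply: differentiable_continuous; apply/derivable1_diffP; exact: (d 1%N).
Qed.

Lemma test_function_out phi x : test_function T phi -> ~~ (0 < x < T) -> phi x = 0.
Proof.
move=> [_ [a [b [a0 bT ab]]]] xT; apply: ab; apply: contra xT => /andP[ax xb].
by rewrite (lt_le_trans a0)//= (le_lt_trans xb).
Qed.

Lemma C0_test_function phi : test_function T phi -> C0 T phi.
Proof.
move=> tphi; split; first exact: test_function_continuous.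
by move=> x; exact: test_function_out.
Qed.

Lemma C0_bounded phi : C0 T phi -> exists2 C : R, 0 <= C & forall x, `|phi x| <= C.
Proof.
move=> [cphi phi0].
have [c _ Hc] : exists2 c, c \in `[0, T] & forall t, t \in `[0, T] -> `|phi t| <= `|phi c|.
  apply: (@EVT_max _ (fun x => `|phi x|)); first exact: ltW.
  by apply: continuous_subspaceT => x; apply: continuous_comp; [exact: cphi|exact: norm_continuous].
exists `|phi c| => // x; have [/andP[x0 xT]|/phi0 ->] := boolP (0 < x < T).
  by apply: Hc; rewrite in_itv/= !ltW.
by rewrite normr0.
Qed.

Lemma C0_measurable phi : C0 T phi -> measurable_fun D phi.
Proof.
move=> [cphi _]; apply: measurable_funTS; exact: continuous_measurable_fun.
Qed.

Lemma L1_C0 phi : C0 T phi -> L1 T phi.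
Proof.
move=> cphi; have [C _ HC] := C0_bounded cphi.
by apply: (@L1_bounded _ C) => //; exact: C0_measurable.
Qed.

Lemma L1M_C0 u phi : L1 T u -> C0 T phi -> L1 T (fun x => u x * phi x).
Proof.
move=> iu cphi; have [C _ HC] := C0_bounded cphi.
by apply: (@L1M _ _ C) => //; exact: C0_measurable.
Qed.

Lemma C0_restrict phi : C0 T phi -> phi \_ D = phi.
Proof.
move=> [_ phi0]; apply/funext => x; rewrite /patch; case: ifPn => //.
by rewrite notin_setE/= in_itv/= => /negP; move/phi0 ->.
Qed.

(** The extension of [phi] by zero is continuous on the whole line, so this holds at 0, at T and
    beyond as well. *)
Lemma is_derive_prim phi (x : R) : C0 T phi -> is_derive x 1 (prim phi) (phi x).
Proof.
move=> cphi.
have H : derivable (prim phi) x 1 /\ derive1 (prim phi) x = phi x.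
  rewrite (_ : prim phi = fun x => \int[leb]_(s in `]-oo, x]) phi s); last first.
    by apply/funext => y; rewrite /prim C0_restrict.
  apply: (@continuous_FTC1 _ phi -oo%O x (x + 1)) => //.
  - by rewrite ltrDl.
  - rewrite -(C0_restrict cphi); apply: (@integrableS _ _ _ leb setT) => //.
    exact/L1_restrict/L1_C0.
  - by rewrite ltNyr.
  - exact: cphi.1.
by case: H => d1 <-; rewrite derive1E; exact/derivableP.
Qed.

Lemma test_function_prim phi : test_function T phi -> Int phi = 0 ->
  test_function T (prim phi).
Proof.
move=> tphi phi0; have cphi := C0_test_function tphi.
have dp : derive1 (prim phi) = phi.
  by apply/funext => x; rewrite derive1E; have [_ ->] := is_derive_prim x cphi.
case: (tphi) => dphi [a [b [a0 bT ab]]]; split.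
  case=> [|n] x; first by have [] := is_derive_prim x cphi.
  by rewrite derive1Sn dp; exact: dphi.
exists a, b; split => // x; rewrite negb_and -!ltNge => /orP[] h.
  by apply: prim_left => s _ sx; apply: ab; rewrite negb_and -ltNge (le_lt_trans sx h).
rewrite prim_right// => s _ xs; apply: ab; rewrite negb_and orbC -ltNge (lt_trans h xs)//.
Qed.

End integrals.

(** * Continuous functions vanishing at the boundary and their dual *)

Section radon.
Context {R : realType}.
Variable T : R.
Hypothesis T0 : 0 < T.
Implicit Types (u v g h phi : R -> R) (m : (R -> R) -> R).

Local Notation leb := (@lebesgue_measure R).
Local Notation D := (`]0, T[%classic : set (measurableTypeR R)).
Local Notation Int u := (Rintegral leb `]0, T[ u).
Local Notation prim := (prim T).

Lemma half_in : 0 < T / 2 < T.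
Proof. by rewrite divr_gt0//= ltr_pdivrMr// ltr_pMr// ltr1n. Qed.

Lemma C0_zero : C0 T (fun=> 0).
Proof. by split=> // x; exact: cvg_cst. Qed.

Lemma C0D phi psi : C0 T phi -> C0 T psi -> C0 T (fun x => phi x + psi x).
Proof.
move=> [c1 z1] [c2 z2]; split=> [x|x xT]; last by rewrite z1// z2// addr0.
by apply: cvgD; [exact: c1|exact: c2].
Qed.

Lemma C0Z (c : R) phi : C0 T phi -> C0 T (fun x => c * phi x).
Proof.
move=> [c1 z1]; split=> [x|x xT]; last by rewrite z1// mulr0.
by apply: cvgM; [exact: cvg_cst|exact: c1].
Qed.

Lemma C0B phi psi : C0 T phi -> C0 T psi -> C0 T (fun x => phi x - psi x).
Proof.
move=> [c1 z1] [c2 z2]; split=> [x|x xT]; last by rewrite z1// z2// subr0.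
by apply: cvgB; [exact: c1|exact: c2].
Qed.

Lemma C0_sum (I : finType) (c : I -> R) (phi : I -> R -> R) : (forall i, C0 T (phi i)) ->
  C0 T (fun x => \sum_i c i * phi i x).
Proof.
move=> H; elim: (index_enum I) => [|i s ih].
  by under eq_fun do rewrite big_nil; exact: C0_zero.
by under eq_fun do rewrite big_cons; exact/C0D/ih/C0Z.
Qed.

Lemma ler_normC phi x : C0 T phi -> `|phi x| <= normC T phi.
Proof.
move=> cphi; have [C C0 HC] := C0_bounded T0 cphi.
have hs : has_sup [set `|phi x| | x in `]0, T[].
  split; first by exists `|phi (T / 2)|, (T / 2) => //=; rewrite in_itv/= half_in.
  by exists C => _ [y _ <-]; exact: HC.
have [xT|/cphi.2 ->] := boolP (0 < x < T).
  by apply: sup_upper_bound => //; exists x => //=; rewrite in_itv.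
rewrite normr0 (@le_trans _ _ `|phi (T / 2)|)//; apply: sup_upper_bound => //.
by exists (T / 2) => //=; rewrite in_itv/= half_in.
Qed.

Lemma normC_le phi (C : R) : (forall x, 0 < x < T -> `|phi x| <= C) -> normC T phi <= C.
Proof.
move=> H; apply: ge_sup.
  by exists `|phi (T / 2)|, (T / 2) => //=; rewrite in_itv/= half_in.
by move=> _ [y yT <-]; apply: H; move: yT; rewrite /= in_itv.
Qed.

Lemma normC_ge0 phi : C0 T phi -> 0 <= normC T phi.
Proof. by move=> /(ler_normC 0); exact: le_trans. Qed.

Section form.
Variable m : (R -> R) -> R.
Hypothesis Mm : Mspace T m.

Lemma MspaceD phi psi : C0 T phi -> C0 T psi -> m (fun x => phi x + psi x) = m phi + m psi.
Proof.
move=> c1 c2; case: Mm => lin _; rewrite -[m phi]mul1r -lin//; congr m.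
by apply/funext => x; rewrite mul1r.
Qed.

Lemma Mspace0 : m (fun=> 0) = 0.
Proof.
have := MspaceD C0_zero C0_zero.
rewrite (_ : (fun x : R => 0 + 0) = (fun=> 0)); last by apply/funext => x; rewrite addr0.
lra.
Qed.

Lemma MspaceZ (c : R) phi : C0 T phi -> m (fun x => c * phi x) = c * m phi.
Proof.
move=> c1; case: Mm => lin _.
rewrite -[RHS]addr0 -Mspace0 -lin//; last exact: C0_zero.
by congr m; apply/funext => x; rewrite addr0.
Qed.

Lemma MspaceB phi psi : C0 T phi -> C0 T psi -> m (fun x => phi x - psi x) = m phi - m psi.
Proof.
move=> c1 c2; rewrite -mulN1r -MspaceZ// -MspaceD//; last exact: C0Z.
by congr m; apply/funext => x; rewrite mulN1r.
Qed.

Lemma Mspace_sum (I : finType) (c : I -> R) (phi : I -> R -> R) : (forall i, C0 T (phi i)) ->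
  m (fun x => \sum_i c i * phi i x) = \sum_i c i * m (phi i).
Proof.
move=> H; suff : C0 T (fun x => \sum_(i <- index_enum I) c i * phi i x) /\
    m (fun x => \sum_(i <- index_enum I) c i * phi i x) =
        \sum_(i <- index_enum I) c i * m (phi i) by case.
elim: (index_enum I) => [|i s [ih1 ih2]].
  under eq_fun do rewrite big_nil; rewrite big_nil Mspace0; split => //; exact: C0_zero.
under eq_fun do rewrite big_cons; rewrite big_cons -ih2 -MspaceZ// -MspaceD//; last exact: C0Z.
by split => //; exact/C0D/ih1/C0Z.
Qed.

Let has_sup_normM : has_sup [set `|m phi| | phi in [set phi | C0 T phi /\ normC T phi <= 1]].
Proof.
split.
  exists `|m (fun=> 0)|, (fun=> 0) => //; split; first exact: C0_zero.
  by apply: normC_le => x _; rewrite normr0.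
case: Mm => _ [C HC]; exists `|C| => _ [phi [cphi phi1] <-].
apply: (le_trans (HC _ cphi)); apply: (@le_trans _ _ (`|C| * normC T phi)).
  by rewrite ler_wpM2r ?normC_ge0// ler_norm.
by rewrite ler_piMr.
Qed.

Lemma ler_normM phi : C0 T phi -> (forall x, `|phi x| <= 1) -> `|m phi| <= normM T m.
Proof.
move=> cphi phi1; apply: sup_upper_bound => //; exists phi => //; split => //.
exact: normC_le.
Qed.

Lemma normM_le (C : R) :
  (forall phi, C0 T phi -> (forall x, `|phi x| <= 1) -> `|m phi| <= C) -> normM T m <= C.
Proof.
move=> H; apply: ge_sup; first by case: has_sup_normM.
move=> _ [phi [cphi phi1] <-]; apply: H => // x.
exact: le_trans (ler_normC _ cphi) _.
Qed.

Lemma normM_ge0 : 0 <= normM T m.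
Proof.
apply: le_trans (ler_normM C0_zero _); first by rewrite normr_ge0.
by move=> x; rewrite normr0.
Qed.

(** By scaling [phi] into the unit ball; as C may be zero, one divides by C + e and lets e tend to
    0. *)
Lemma ler_normMM phi (C : R) : C0 T phi -> (forall x, `|phi x| <= C) -> `|m phi| <= normM T m * C.
Proof.
move=> cphi phiC; have C0 : 0 <= C by apply: le_trans (phiC 0).
have H e : 0 < e -> `|m phi| <= normM T m * (C + e).
  move=> e0; have Ce : 0 < C + e by rewrite ltr_wpDl.
  have Ci : 0 <= (C + e)^-1 by rewrite invr_ge0 ltW.
  rewrite -ler_pdivrMr// mulrC -[X in X * _]ger0_norm// -normrM -MspaceZ//.
  apply: ler_normM; first exact: C0Z.
  move=> x; rewrite normrM ger0_norm// ler_pdivrMl// mulr1.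
  by rewrite (le_trans (phiC x))// lerDl ltW.
apply/ler_addgt0Pr => e e0.
have N0 := normM_ge0.
have N1 : 0 < normM T m + 1 by rewrite ltr_wpDl.
apply: (le_trans (H (e / (normM T m + 1)) _)); first by rewrite divr_gt0.
rewrite mulrDr lerD2l mulrA ler_pdivrMr// mulrC ler_wpM2l ?ltW//; lra.
Qed.

End form.

Lemma Mspace_ext m1 m2 : (forall phi, C0 T phi -> m1 phi = m2 phi) -> Mspace T m1 -> Mspace T m2.
Proof.
move=> m12 [lin [C HC]]; split.
  by move=> a u v cu cv; rewrite -!m12 ?lin//; exact/C0D/cv/C0Z.
by exists C => u cu; rewrite -m12// HC.
Qed.

Lemma normM_ext m1 m2 : (forall phi, C0 T phi -> m1 phi = m2 phi) -> normM T m1 = normM T m2.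
Proof.
move=> m12; rewrite /normM; congr sup; apply/seteqP; split=> _ [phi [cphi phi1] <-];
  by exists phi => //; rewrite m12.
Qed.

Lemma Mspace_lin (a : R) m1 m2 : Mspace T m1 -> Mspace T m2 ->
  Mspace T (fun phi => a * m1 phi + m2 phi).
Proof.
move=> M1 M2; split=> [c u v cu cv|].
  by rewrite !MspaceD ?MspaceZ//; [ring|exact: C0Z..].
exists (`|a| * normM T m1 + normM T m2) => u cu.
have nu x := ler_normC x cu.
rewrite (le_trans (ler_normD _ _))// mulrDl lerD ?ler_normMM// normrM -mulrA.
by rewrite ler_wpM2l// ler_normMM.
Qed.

Lemma Mspace_dirac (x : R) : Mspace T (fun phi => phi x).
Proof. by split => //; exists 1 => u cu; rewrite mul1r; exact: ler_normC. Qed.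

Lemma Mspace_cst0 : Mspace T (fun=> 0).
Proof.
split=> [a u v _ _|]; first by rewrite mulr0 addr0.
by exists 0 => u _; rewrite normr0 mul0r.
Qed.

Lemma Mspace_density w : L1 T w -> Mspace T (density T w).
Proof.
move=> iw; split=> [a u v cu cv|].
  rewrite /density -(IntZ a) -?IntD; last 3 first.
    exact/L1Z/L1M_C0.
    exact: L1M_C0.
    exact: L1M_C0.
  by apply: eq_Int => x _; ring.
exists (Int (fun x => `|w x|)) => u cu; rewrite /density.
apply: (le_trans (Int_abs _)); first exact: L1M_C0.
rewrite mulrC -(IntZ (normC T u)); last exact: L1_abs.
apply: le_Int; [exact/L1_abs/L1M_C0|exact/L1Z/L1_abs|].
by move=> x _; rewrite normrM mulrC ler_wpM2r// ler_normC.
Qed.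

End radon.

(** * Integration by parts against an arbitrary integrable function *)

Section test_functions.
Context {R : realType}.
Variable T : R.
Hypothesis T0 : 0 < T.
Implicit Types (u v g h phi psi : R -> R) (m : (R -> R) -> R).

Local Notation leb := (@lebesgue_measure R).
Local Notation D := (`]0, T[%classic : set (measurableTypeR R)).
Local Notation Int u := (Rintegral leb `]0, T[ u).
Local Notation prim := (prim T).

Lemma test_function_lin (c : R) phi psi : test_function T phi -> test_function T psi ->
  test_function T (fun x => c * phi x + psi x).
Proof.
move=> [/derivable_uptoP d1 [a [b [a0 bT ab]]]] [/derivable_uptoP d2 [a' [b' [a'0 b'T ab']]]];
    split.
  apply/derivable_uptoP => n; apply: derivable_uptoD => //.
  exact/derivable_uptoM/d1/derivable_upto_cst.
exists (Num.min a a'), (Num.max b b'); split.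
- by rewrite lt_min a0.
- by rewrite gt_max bT.
- move=> x; rewrite ge_min le_max => H.
  rewrite ab ?ab' ?mulr0 ?addr0//; apply: contra H => /andP[-> ->]; rewrite ?orbT//.
Qed.

Lemma test_function0 : test_function T (fun=> 0).
Proof.
split; first by apply/derivable_uptoP => n; exact: derivable_upto_cst.
exists (T / 2), (T / 2); split => //; by case/andP : (half_in T0).
Qed.

Lemma test_functionZ (c : R) phi : test_function T phi -> test_function T (fun x => c * phi x).
Proof.
move=> t; rewrite (_ : (fun _ => _) = fun x => c * phi x + 0).
  exact/test_function_lin/test_function0.
by apply/funext => x; rewrite addr0.
Qed.

(** The rays generate the Borel sets. Clipping at 0 keeps the bumps supported in ]0, T[ and changes
    nothing there. *)
Lemma bump_cvg_ray (a x : R) : D x ->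
  smooth_bump (Num.max a 0) T n.+1 x @[n --> \oo] --> (\1_(`]a, +oo[) x : R).
Proof.
rewrite /= in_itv/= => /andP[x0 xT].
suff -> : \1_(`]a, +oo[) x = \1_(`](Num.max a 0), T[) x :> R by exact: cvg_smooth_bump.
rewrite !indicE; congr (_%:R); congr nat_of_bool; apply/idP/idP; rewrite !inE/= !in_itv/= ?andbT.
  by move=> ax; rewrite xT andbT gt_max ax.
by rewrite gt_max => /andP[/andP[]].
Qed.

Lemma bump_ray_test_function (a : R) n : test_function T (smooth_bump (Num.max a 0) T n.+1).
Proof. by apply: smooth_bump_test_function => //; rewrite le_max lexx orbT. Qed.

(** Bumps converge to 1 in L^1, so their integrals tend to T > 0; one within distance less than T of
    this limit is nonzero and can be normalized. *)
Lemma mean_one_test_function : exists2 theta, test_function T theta & Int theta = 1.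
Proof.
pose b n := smooth_bump (Num.max 0 0) T n.+1 : R -> R.
have tb n : test_function T (b n) by exact: bump_ray_test_function.
have Lb n : L1 T (b n) by apply: L1_C0 => //; exact: C0_test_function.
have [L H] : L1 T (\1_(`]0, +oo[)) /\ Int (fun x => `|b n x - \1_(`]0,
    +oo[) x|) @[n --> \oo] --> (0 : R).
  apply: (@Int_dominated _ _ _ _ (fun=> 1)) => [n|x Dx||n x Dx].
  - exact: L1_measurable.
  - exact: bump_cvg_ray.
  - exact: L1_cst.
  - by rewrite ger0_norm ?smooth_bump_ge0 ?smooth_bump_le1.
have /cvgrPdist_lt/(_ _ T0)[N _ /(_ N (leqnn _))] := Int_cvg Lb L H.
rewrite (@eq_Int _ _ _ (fun=> 1)); last first.
  move=> x; rewrite /= in_itv/= => /andP[x0 _]; rewrite indicE mem_set//=.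
  by rewrite in_itv/= x0.
rewrite Int_cst// mul1r => {}H.
have I0 : Int (b N) != 0.
  by apply: contraTneq H => ->; rewrite subr0 gtr0_norm// ltxx.
exists (fun x => (Int (b N))^-1 * b N x); first exact: test_functionZ.
by rewrite IntZ// mulVf.
Qed.

End test_functions.

Import HBSimple HBNNSimple.

Section integration_by_parts.
Context {R : realType}.
Variable T : R.
Hypothesis T0 : 0 < T.
Implicit Types (g h phi psi : R -> R).

Local Notation leb := (@lebesgue_measure R).
Local Notation D := (`]0, T[%classic : set (measurableTypeR R)).
Local Notation Int u := (Rintegral leb `]0, T[ u).
Local Notation prim := (prim T).

Variables (u : R -> R) (m : (R -> R) -> R).
Hypotheses (iu : L1 T u) (Mm : Mspace T m) (Du : is_distributional_derivative T u m).

(** A test function of mean zero is the derivative of a test function, its primitive. *)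
Let ibp_test psi : test_function T psi -> Int psi = 0 ->
  m (prim psi) = - Int (fun x => u x * psi x).
Proof.
move=> tpsi psi0; rewrite Du; last exact: test_function_prim.
congr (- _); apply: eq_Int => x _; congr (_ * _); rewrite derive1E.
by have [_ ->] := is_derive_prim T0 x (C0_test_function tpsi).
Qed.

Section fixed_theta.
Variable theta : R -> R.
Hypotheses (ttheta : test_function T theta) (theta1 : Int theta = 1).

(* [Phi h] is the defect in the integration by parts formula after the mean of [h] has
   been removed by means of [theta]. It vanishes on test functions and is continuous under
   dominated convergence, so the sets whose indicator it kills form a Dynkin system
   containing the rays. *)
Let V h := L1 T h /\ L1 T (fun x => u x * h x).
Let P h := fun x => h x - Int h * theta x.
Let Phi h := m (prim (P h)) + Int (fun x => u x * P h x).

Let Ltheta : L1 T theta. Proof. exact/L1_C0/C0_test_function. Qed.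
Let Lutheta : L1 T (fun x => u x * theta x). Proof. exact/L1M_C0/C0_test_function. Qed.

Let LP h : V h -> L1 T (P h).
Proof. by move=> [h1 _]; exact/L1B/L1Z. Qed.

Let LuPE h x : u x * P h x = u x * h x - Int h * (u x * theta x).
Proof. rewrite /P; ring. Qed.

Let LuP h : V h -> L1 T (fun x => u x * P h x).
Proof.
move=> [_ h2]; apply: (L1_eq (u := fun x => u x * h x - Int h * (u x * theta x))).
  by move=> x _; rewrite LuPE.
exact/L1B/L1Z.
Qed.

Let IntP h : V h -> Int (P h) = 0.
Proof. by move=> [h1 h2]; rewrite IntB//; [rewrite IntZ// theta1; ring|exact: L1Z]. Qed.

Let C0P h : V h -> C0 T (prim (P h)).
Proof. by move=> Vh; apply: C0_prim => //; [exact: LP|exact: IntP]. Qed.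

Let V_lin (c : R) h k : V h -> V k -> V (fun x => c * h x + k x).
Proof.
move=> [h1 h2] [k1 k2]; split; first exact/L1D/k1/L1Z.
apply: (L1_eq (u := fun x => c * (u x * h x) + u x * k x)); first by move=> x _; ring.
exact/L1D/k2/L1Z.
Qed.

Let Phi_lin (c : R) h k : V h -> V k -> Phi (fun x => c * h x + k x) = c * Phi h + Phi k.
Proof.
move=> Vh Vk.
have Plin : P (fun x => c * h x + k x) = fun x => c * P h x + P k x.
  apply/funext => x; rewrite /P IntD; [|exact: L1Z Vh.1|exact: Vk.1].
  rewrite IntZ; [ring|exact: Vh.1].
rewrite /Phi Plin (_ : prim _ = fun x => c * prim (P h) x + prim (P k) x); last first.
  apply/funext => x; rewrite primD; [|exact/L1Z/LP|exact/LP].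
  by rewrite primZ//; exact: LP.
rewrite (MspaceD Mm); [|exact/C0Z/C0P|exact: C0P].
rewrite (MspaceZ Mm); last exact: C0P.
rewrite (@eq_Int _ _ _ (fun x => c * (u x * P h x) + u x * P k x)); last by move=> x _; ring.
have arith (a b d e : R) : c * a + b + (c * d + e) = c * (a + d) + (b + e) by ring.
rewrite IntD; [|exact/L1Z/LuP|exact: LuP].
by rewrite IntZ; [exact: arith|exact: LuP].
Qed.

(** The sup norm of a primitive is at most the L^1 norm of its integrand, and removing the mean
    multiplies that norm by at most 1 + |theta|_1. The last summand of K comes from the part of
    [u * P h] along [theta]. *)
Let Phi_bound : exists K : R, forall h, V h ->
  `|Phi h| <= K * Int (fun x => `|h x|) + Int (fun x => `|u x * h x|).
Proof.
exists (normM T m * (1 + Int (fun x => `|theta x|)) + `|Int (fun x => u x * theta x)|) => h Vh.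
have hh : `|Int h| <= Int (fun x => `|h x|) by apply: Int_abs; exact: Vh.1.
have A : Int (fun x => `|P h x|) <= Int (fun x => `|h x|) * (1 + Int (fun x => `|theta x|)).
  apply: (@le_trans _ _ (Int (fun x => `|h x| + `|Int h| * `|theta x|))).
    apply: le_Int; [exact/L1_abs/LP| |].
      by apply: L1D; [exact/L1_abs/Vh.1|exact/L1Z/L1_abs].
    by move=> x _; rewrite (le_trans (ler_normB _ _))// normrM.
  rewrite IntD; [|exact/L1_abs/Vh.1|exact/L1Z/L1_abs].
  rewrite IntZ; last exact/L1_abs.
  by rewrite mulrDr mulr1 lerD2l ler_wpM2r// Int_abs_ge0.
have B : `|m (prim (P h))| <= normM T m * Int (fun x => `|P h x|).
  apply: ler_normMM => //; first exact: C0P.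
  by move=> x; apply: prim_abs; exact: LP.
have C : `|Int (fun x => u x * P h x)| <= Int (fun x => `|u x * h x|) +
    `|Int (fun x => u x * theta x)| * Int (fun x => `|h x|).
  under eq_Rintegral do rewrite LuPE.
  rewrite IntB; [|exact: Vh.2|exact: L1Z].
  rewrite IntZ// (le_trans (ler_normB _ _))// lerD//.
    by apply: Int_abs; exact: Vh.2.
  by rewrite normrM mulrC ler_wpM2l.
have N0 := normM_ge0 T0 Mm.
rewrite (le_trans (ler_normD _ _))// (le_trans (lerD B C))//.
have {}A := ler_wpM2l N0 A.
have arith (n p q a b c : R) : n * p <= n * (a * (1 + b)) ->
    n * p + (q + c * a) <= (n * (1 + b) + c) * a + q by lra.
exact: arith.
Qed.

Let V_le (h k : R -> R) : measurable_fun D h -> (forall x, D x -> `|h x| <= k x) -> V k -> V h.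
Proof.
move=> mh hk [k1 k2]; split; first exact: L1_le hk k1.
apply: (L1_le (v := fun x => `|u x * k x|)); last exact: L1_abs.
  by apply: measurable_funM => //; exact: L1_measurable.
by move=> x Dx; rewrite !normrM ler_wpM2l// (le_trans (hk _ Dx))// ler_norm.
Qed.

(** Since [Phi (h_ n)] is zero, |Phi h| = |Phi (h_n - h)|, and [Phi_bound] controls this by two L^1
    norms that tend to zero. *)
Let Phi_cvg (h_ : nat -> R -> R) h k : (forall n, measurable_fun D (h_ n)) ->
  (forall x, D x -> h_ n x @[n --> \oo] --> h x) -> V k ->
  (forall n x, D x -> `|h_ n x| <= k x) -> (forall n, Phi (h_ n) = 0) -> V h /\ Phi h = 0.
Proof.
move=> mh hh Vk hk Ph.
have Vn n : V (h_ n) by exact: V_le (hk n) Vk.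
have [h1 c1] := Int_dominated mh hh Vk.1 hk.
have [||||h2 c2] := @Int_dominated _ T (fun n x => u x * h_ n x) (fun x => u x * h x) (fun x =>
    `|u x * k x|).
- by move=> n; apply: measurable_funM => //; exact: L1_measurable.
- by move=> x Dx; apply: cvgM; [exact: cvg_cst|exact: hh].
- exact/L1_abs/Vk.2.
- by move=> n x Dx; rewrite !normrM ler_wpM2l// (le_trans (hk _ _ Dx))// ler_norm.
have Vh : V h by [].
split => //; apply/eqP; rewrite -normr_le0.
have [K HK] := Phi_bound.
have cv : K * Int (fun x => `|h_ n x - h x|) + Int (fun x =>
    `|u x * h_ n x - u x * h x|) @[n --> \oo] --> (0 : R).
  rewrite -[X in _ --> X](_ : K * 0 + 0 = 0); last by rewrite mulr0 addr0.
  by apply: cvgD => //; apply: cvgM => //; exact: cvg_cst.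
apply: (ler_cvg_to (cvg_cst _) cv); apply: nearW => n.
have := HK _ (V_lin (-1) Vh (Vn n)).
rewrite Phi_lin// Ph addr0 mulN1r normrN.
rewrite (@eq_Int _ _ (fun x => `|-1 * h x + h_ n x|) (fun x => `|h_ n x - h x|)); last first.
  by move=> x _; rewrite mulN1r addrC.
rewrite (@eq_Int _ _ (fun x => `|u x * (-1 * h x + h_ n x)|) (fun x =>
    `|u x * h_ n x - u x * h x|))//.
by move=> x _; rewrite mulN1r addrC mulrBr.
Qed.

Let V_bounded h (C : R) : measurable_fun D h -> (forall x, D x -> `|h x| <= C) -> V h.
Proof.
by move=> mh hC; split; [exact: L1_bounded hC|exact: L1M hC].
Qed.

Let V_indic (A : set (measurableTypeR R)) : measurable A -> V (\1_A).
Proof.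
move=> mA; apply: (@V_bounded _ 1); first exact: measurable_indic.
by move=> x _; rewrite indicE; case: (_ \in _); rewrite ?normr1 ?normr0.
Qed.

Let Phi_test psi : test_function T psi -> Phi psi = 0.
Proof.
move=> tpsi; rewrite /Phi.
have E : P psi = fun x => (- Int psi) * theta x + psi x by apply/funext => x; rewrite /P; ring.
have tP : test_function T (P psi) by rewrite E; exact: test_function_lin.
rewrite ibp_test//; first by rewrite addNr.
have cpsi := C0_test_function tpsi; apply: IntP.
apply: (@V_bounded _ (normC T psi)); first exact: C0_measurable.
by move=> x _; exact: ler_normC.
Qed.

Let Phi_ray (a : R) : Phi (\1_(`]a, +oo[)) = 0.
Proof.
have [|||||_ //] := @Phi_cvg (fun n => smooth_bump (Num.max a 0) T n.+1) (\1_(`]a, +oo[)) (fun=> 1).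
- by move=> n; apply: C0_measurable; exact/C0_test_function/bump_ray_test_function.
- by move=> x; exact: bump_cvg_ray.
- by apply: (@V_bounded _ `|1|).
- by move=> n x Dx; rewrite ger0_norm ?smooth_bump_ge0 ?smooth_bump_le1.
- by move=> n; exact/Phi_test/bump_ray_test_function.
Qed.

(** The bound for [Phi (k - h)] is zero. This lets the ray from 0 stand for the whole line. *)
Let eq_Phi h k : V h -> (forall x, D x -> h x = k x) -> Phi h = Phi k.
Proof.
move=> Vh hk; have Vk : V k.
  split; first by apply: L1_eq hk _; exact: Vh.1.
  by apply: L1_eq Vh.2 => x Dx; rewrite hk.
have [K HK] := Phi_bound.
have := HK _ (V_lin (-1) Vh Vk).
rewrite (@eq_Int _ _ (fun x => `|-1 * h x + k x|) (fun=> 0)); last first.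
  by move=> x Dx; rewrite hk// mulN1r addNr normr0.
rewrite (@eq_Int _ _ (fun x => `|u x * (-1 * h x + k x)|) (fun=> 0)); last first.
  by move=> x Dx; rewrite hk// mulN1r addNr mulr0 normr0.
have I0 : Int (fun=> 0) = 0 by rewrite Int_cst// mul0r.
rewrite I0.
have arith (a b c : R) : c = -1 * a + b -> `|c| <= K * 0 + 0 -> a = b.
  by move=> ->; rewrite mulr0 addr0 normr_le0 mulN1r addrC subr_eq0 => /eqP.
exact: arith (Phi_lin (-1) Vh Vk).
Qed.

Let Phi_indic (A : set (measurableTypeR R)) : measurable A -> Phi (\1_A) = 0.
Proof.
move=> mA.
have mG : @measurable _ (measurableTypeR R) =
    <<s @RGenOInfty.G R >> by exact: RGenOInfty.measurableE.
apply: (@dynkin_induction _ (measurableTypeR R) (@RGenOInfty.G R) (fun A => Phi (\1_A) = 0)).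
- exact: mG.
- move=> _ _ [x ->] [y ->]; exists (Num.max x y).
  by apply/seteqP; split => z /=; rewrite !in_itv/= !andbT gt_max => /andP.
- rewrite -(Phi_ray 0); apply: eq_Phi; first exact: V_indic.
  move=> x; rewrite /= in_itv/= => /andP[x0 _].
  by rewrite !indicE !mem_set//= in_itv/= x0.
- by move=> _ [x ->]; exact: Phi_ray.
- move=> S mS PS.
  have V1 : V (fun=> 1) by apply: (@V_bounded _ `|1|).
  have P1 : Phi (fun=> 1) = 0.
    rewrite -(Phi_ray 0); apply: eq_Phi => // x; rewrite /= in_itv/= => /andP[x0 _].
    by rewrite !indicE mem_set//= in_itv/= x0.
  have := Phi_lin (-1) (V_indic mS) V1; rewrite PS P1 mulr0 addr0 => <-.
  congr Phi; apply/funext => x; rewrite !indicE in_setC.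
  by case: (_ \in _) => /=; ring.
- move=> F mF tF PF.
  (* Disjointness makes the partial sums indicators, hence dominated by 1; at a point of [F k] they
     equal 1 as soon as n > k. *)
  pose S n x : R := \sum_(i < n) \1_(F i) x.
  have S0 x n : (forall k, ~ F k x) -> S n x = 0.
    by move=> Fx; rewrite /S big1// => i _; rewrite indicE memNset.
  have S1 x n k : F k x -> S n x = (k < n)%N%:R.
    move=> Fkx; have Fi i : i != k -> \1_(F i) x = 0 :> R.
      move=> ik; rewrite indicE memNset// => Fix_.
      by move/trivIsetP : tF => /(_ i k I I ik); rewrite -subset0 => /(_ x); apply.
    rewrite /S; case: ltnP => [kn|nk].
      rewrite (bigD1 (Ordinal kn))//= indicE mem_set// big1 ?addr0// => i ik.
      by apply: Fi; apply: contra ik => /eqP ik; apply/eqP/val_inj.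
    rewrite big1// => i _; apply: Fi; apply: contraTneq nk => <-.
    by rewrite -ltnNge.
  have mS n : measurable_fun D (S n).
    by apply: measurable_sum => i; exact: measurable_indic.
  have bS n x : `|S n x| <= 1.
    have [[k Fkx]|nF] := pselect (exists k, F k x).
      by rewrite (S1 _ _ k)//; case: (_ < _)%N; rewrite ?normr1 ?normr0.
    by rewrite S0 ?normr0// => k Fk; apply: nF; exists k.
  have PS n : Phi (S n) = 0.
    elim: n => [|n ih].
      rewrite (_ : S 0%N = fun=> 0); first exact/Phi_test/test_function0.
      by apply/funext => x; rewrite /S big_ord0.
    have VS : V (S n) by apply: (@V_bounded _ 1).
    have arith (a b c : R) : c = 1 * a + b -> a = 0 -> b = 0 -> c = 0 by lra.
    apply: arith ih (PF n); rewrite -(Phi_lin 1 VS (V_indic (mF n))).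
    by congr Phi; apply/funext => x; rewrite /S big_ord_recr/= mul1r.
  have [|||||_ //] := @Phi_cvg S (\1_(\bigcup_k F k)) (fun=> 1).
  + by [].
  + move=> x _; have [[k Fkx]|nF] := pselect (exists k, F k x).
      rewrite indicE mem_set; last by exists k.
      apply: cvg_near_cst; near=> n; rewrite (S1 _ _ k)//.
      suff -> : (k < n)%N by [].
      by near: n; exact: nbhs_infty_gt.
    rewrite indicE memNset; last by move=> [k _ Fk]; apply: nF; exists k.
    apply: cvg_near_cst; apply: nearW => n; rewrite S0// => k Fk; apply: nF; exists k.
    by [].
  + by apply: (@V_bounded _ `|1|).
  + by [].
  + by [].
- by rewrite -mG.
Unshelve. all: by end_near. Qed.

Let Phi_simple (f : {nnsfun measurableTypeR R >-> R}) : V f /\ Phi f = 0.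
Proof.
have [s E] : exists s : seq R, (f : _ -> _) = fun x => \sum_(y <- s) y * \1_(f @^-1` [set y]) x.
  exists (finmap.enum_fset (fset_set (range f))).
  by apply/funext => x; rewrite fimfunE fsbig_finite.
rewrite E; elim: s {E} => [|y s [ih1 ih2]].
  under eq_fun do rewrite big_nil; split; last exact/Phi_test/test_function0.
  by apply: (@V_bounded _ 0) => // x _; rewrite normr0.
under eq_fun do rewrite big_cons.
have mf : measurable (f @^-1` [set y]) by [].
have Vy := V_indic mf.
split; first exact: V_lin.
by rewrite (Phi_lin y Vy ih1) ih2 addr0 Phi_indic// mulr0.
Qed.

(** Simple functions approximate [h] from below, so [h] itself dominates them. *)
Let Phi_ge0 h : V h -> (forall x, 0 <= h x) -> Phi h = 0.
Proof.
move=> Vh h0.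
have mD : measurable D by exact: measurable_itv.
have mh : measurable_fun D (EFin \o h) by apply/measurable_EFinP; exact: L1_measurable Vh.1.
pose f_ := nnsfun_approx mD mh.
have [|||||_ //] := @Phi_cvg (fun n => f_ n) h h.
- by move=> n; exact: measurable_funTS.
- move=> x Dx.
  have := @cvg_nnsfun_approx _ _ _ _ mD _ mh (fun y _ => h0 y) x Dx.
  by move/fine_cvgP => [_].
- by [].
- move=> n x Dx; rewrite ger0_norm//.
  have := @le_approx _ _ _ D (EFin \o h) n x _ Dx; rewrite nnsfun_approxE lee_fin; apply.
  by move=> y _; rewrite lee_fin.
- by move=> n; case: (Phi_simple (f_ n)).
Qed.

Let Phi_eq0 h : V h -> Phi h = 0.
Proof.
move=> Vh.
have mh := L1_measurable Vh.1.
have Vp : V (fun x => Num.max (h x) 0).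
  apply: (@V_le _ (fun x => `|h x|)).
  - exact: measurable_maxr.
  - by move=> x _; rewrite /Num.max; case: ifP => // _; rewrite normr0.
  - split; first exact: L1_abs Vh.1.
    apply: (L1_le (v := fun x => `|u x * h x|)); last exact/L1_abs/Vh.2.
      apply: measurable_funM; [exact: L1_measurable|exact: measurableT_comp].
    by move=> x _; rewrite !normrM normr_id.
(* This is the negative part of [h]. *)
have Vn : V (fun x => (-1) * h x + Num.max (h x) 0) by exact: V_lin.
have Pp : Phi (fun x => Num.max (h x) 0) = 0.
  by apply: Phi_ge0 => // x; rewrite le_max lexx orbT.
have Pn : Phi (fun x => (-1) * h x + Num.max (h x) 0) = 0.
  apply: Phi_ge0 => // x; rewrite mulN1r addrC subr_ge0 le_max lexx//.
have arith (a b c : R) : c = -1 * a + b -> c = 0 -> b = 0 -> a = 0 by lra.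
exact: arith (Phi_lin (-1) Vh Vp) Pn Pp.
Qed.

Lemma ibp_theta g : V g -> Int g = 0 -> m (prim g) = - Int (fun x => u x * g x).
Proof.
move=> Vg g0; have := Phi_eq0 Vg.
rewrite /Phi (_ : P g = g); first by move/eqP; rewrite addr_eq0 => /eqP.
by apply/funext => x; rewrite /P g0 mul0r subr0.
Qed.

End fixed_theta.

(** Mean zero puts [prim g] in C_0, where [m] is defined. The gradient is square integrable but
    possibly unbounded, hence the separate condition on the product [u g]. *)
Lemma distributional_ibp g : L1 T g -> L1 T (fun x => u x * g x) -> Int g = 0 ->
  m (prim g) = - Int (fun x => u x * g x).
Proof.
move=> g1 g2; have [theta ttheta theta1] := mean_one_test_function T0.
exact: (ibp_theta ttheta theta1 (conj g1 g2)).
Qed.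

End integration_by_parts.

(** * Density of primitives and the du Bois-Reymond lemma *)

Section ftc.
Context {R : realType}.
Local Notation leb := (@lebesgue_measure R).

Lemma integrable_cc_continuous (a b : R) (f : R -> R) : continuous f ->
  leb.-integrable `[a, b] (EFin \o f).
Proof.
move=> cf; apply: continuous_compact_integrable; first exact: segment_compact.
exact: continuous_subspaceT.
Qed.

Lemma integrable_oo_continuous (a b : R) (f : R -> R) : continuous f ->
  leb.-integrable `]a, b[ (EFin \o f).
Proof.
move=> /(integrable_cc_continuous a b) fi.
by apply: integrableS fi => //; exact: subset_itv_oo_cc.
Qed.

Lemma Rintegral_FTC (a b : R) (F f : R -> R) : a < b ->
  (forall x, is_derive x (1 : R) F (f x)) -> continuous f ->
  \int[leb]_(x in `]a, b[) f x = F b - F a.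
Proof.
move=> ab dF cf.
have cF x : {for x, continuous F}.
  by apply: differentiable_continuous; apply/derivable1_diffP; have [] := dF x.
have fi := integrable_cc_continuous a b cf.
rewrite Rintegral_itv_bndo_bndc; last exact: integrable_oo_continuous.
rewrite Rintegral_itv_obnd_cbnd; last first.
  by apply: integrableS fi => //; apply: subset_itvr; rewrite bnd_simp.
rewrite /Rintegral (continuous_FTC2 ab (F := F))//.
- exact: continuous_subspaceT.
- split; last 2 first.
  + exact/cvg_at_right_filter/cF.
  + exact/cvg_at_left_filter/cF.
  + by move=> x _; have [] := dF x.
- by move=> x _; rewrite derive1E; have [_ ->] := dF x.
Qed.

(** Joint continuity of phi(x + h) - phi(x) at h = 0, made uniform by compactness in x. The point x
    + h may leave [a, b], as it does for averages near T. *)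
Lemma uniform_continuity_itv (a b : R) (phi : R -> R) (e : R) : continuous phi -> 0 < e ->
  exists2 d : R, 0 < d & forall x h, a <= x <= b -> `|h| < d -> `|phi (x + h) - phi x| <= e.
Proof.
move=> cphi e0.
have /compact_near_coveringP/(_ R (nbhs (0 : R)) (fun h x =>
    `|phi (x + h) - phi x| <= e)) H := @segment_compact R a b.
have : \forall h \near (0 : R), `[a, b]%classic `<=` (fun x => `|phi (x + h) - phi x| <= e).
  apply: H => x _.
  have c : (fun z : R * R => phi (z.1 + z.2) - phi z.1) z @[z --> (x,
      0 : R)] --> phi (x + 0) - phi x.
    apply: cvgB.
      have A : (fun z : R * R => z.1 + z.2) z @[z --> (x, 0 : R)] --> (x + 0 : R).
        by apply: cvgD; [exact: cvg_fst|exact: cvg_snd].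
      exact: (cvg_comp _ _ A (cphi _)).
    have A : (fun z : R * R => z.1) z @[z --> (x, 0 : R)] --> (x : R) by exact: cvg_fst.
    exact: (cvg_comp _ _ A (cphi _)).
  rewrite addr0 subrr in c.
  move/cvgrPdist_le : c => /(_ e e0); apply: filterS => -[y h] /=.
  by rewrite sub0r normrN.
move=> /nbhs_ballP[d /= d0 Hd]; exists d => // x h xab hd.
apply: (Hd h); last by rewrite /= in_itv.
by rewrite /ball/= sub0r normrN.
Qed.

End ftc.

Section density.
Context {R : realType}.
Variable T : R.
Hypothesis T0 : 0 < T.
Implicit Types (u v g h phi psi : R -> R) (m : (R -> R) -> R).

Local Notation leb := (@lebesgue_measure R).
Local Notation D := (`]0, T[%classic : set (measurableTypeR R)).
Local Notation Int u := (Rintegral leb `]0, T[ u).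
Local Notation prim := (prim T).

Lemma L1_continuous f : continuous f -> L1 T f.
Proof. exact: integrable_oo_continuous. Qed.

Lemma prim_FTC F f x : (forall x, is_derive x (1 : R) F (f x)) -> continuous f ->
  0 <= x <= T -> prim f x = F x - F 0.
Proof.
move=> dF cf /andP[x0 xT].
have [->|xn0] := eqVneq x 0.
  rewrite subrr; apply: (prim_left T0) => s; rewrite /= in_itv/= => /andP[s0 _] sx.
  by have := lt_le_trans s0 sx; rewrite ltxx.
have {xn0}x0 : 0 < x by rewrite lt_neqAle eq_sym xn0.
move: xT; rewrite le_eqVlt => /predU1P[->|xT].
  rewrite prim_right ?Rintegral_FTC// => s; rewrite /= in_itv/= => /andP[_ sT] Ts.
  by have := lt_trans sT Ts; rewrite ltxx.
by rewrite prim_pbar ?x0// ?/pbar ?Rintegral_FTC//; exact: L1_continuous.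
Qed.

(* The approximation is the moving average of [phi], corrected by an affine function to
   vanish at both end points. *)
Lemma prim_dense phi (e : R) : C0 T phi -> 0 < e ->
  exists g, [/\ continuous g, Int g = 0 & forall x, `|phi x - prim g x| <= e].
Proof.
move=> cphi e0.
(* The four quarters: one for the averaging error, two for the linear correction [c * x], one for
   [F 0]. *)
have e40 : 0 < e / 4%:R by rewrite divr_gt0.
have [d d0 Hd] := uniform_continuity_itv 0 T cphi.1 e40.
pose h := d / 2%:R.
have h0 : 0 < h by rewrite divr_gt0.
have hd : h < d by rewrite ltr_pdivrMr// ltr_pMr// ltr1n.
pose F x := h^-1 * (prim phi (x + h) - prim phi x).
pose f x := h^-1 * (phi (x + h) - phi x).
have cf : continuous f.
  move=> x; apply: cvgM; first exact: cvg_cst.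
  apply: cvgB; last exact: cphi.1.
  apply: (@continuous_comp _ _ _ (fun x : R => x + h) phi); last exact: cphi.1.
  by apply: cvgD; [exact: cvg_id|exact: cvg_cst].
have dF x : is_derive x (1 : R) F (f x).
  rewrite /F /f.
  have d1 : is_derive x (1 : R) (fun y => prim phi (y + h)) (phi (x + h)).
    rewrite -[phi _]mulr1; apply: (@is_derive1_comp _ (prim phi) (fun y => y + h)).
      exact: is_derive_prim.
    by apply: is_derive_eq; rewrite addr0.
  have d2 := is_derive_prim T0 x cphi.
  by apply: is_derive_eq.
have Fphi x : 0 <= x <= T -> `|F x - phi x| <= e / 4%:R.
  move=> xT.
  (* By the mean value theorem the average over [x, x + h] is a value of [phi] at distance at most h
     < d from x. *)
  have [z] := @MVT_segment _ (prim phi) phi x (x + h) (ltac:(by rewrite lerDl ltW))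
    (fun y _ => is_derive_prim T0 y cphi) (continuous_subspaceT (continuous_prim (L1_C0 T0 cphi))).
  rewrite in_itv/= addrAC subrr add0r => /andP[xz zxh] E.
  rewrite /F E mulrCA mulVf ?gt_eqF// mulr1.
  rewrite (_ : z = x + (z - x)); last by rewrite addrC subrK.
  apply: Hd => //.
  by rewrite ger0_norm ?subr_ge0// (le_lt_trans _ hd)// lerBlDl.
have F0 : `|F 0| <= e / 4%:R.
  have := Fphi 0; rewrite cphi.2 ?ltxx// subr0; apply; rewrite lexx ltW//.
have FT : `|F T| <= e / 4%:R.
  have := Fphi T; rewrite cphi.2 ?ltxx ?andbF// subr0; apply; rewrite lexx ltW//.
(* This slope makes [G] equal at both ends, so that its derivative [g] has mean zero. *)
pose c := (F T - F 0) / T.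
pose G x := F x - c * x.
pose g x := f x - c.
have dG x : is_derive x (1 : R) G (g x).
  have dFx := dF x; rewrite /G /g.
  by apply: is_derive_eq; rewrite /GRing.scale/= mulr1.
have cg : continuous g by move=> x; apply: cvgB; [exact: cf|exact: cvg_cst].
have g0 : Int g = 0.
  by rewrite (Rintegral_FTC T0 dG cg) /G /c divfK ?gt_eqF// mulr0; ring.
exists g; split => // x.
have [xT|xT] := boolP (0 < x < T); last first.
  by rewrite cphi.2// (C0_prim T0 _ g0).2 ?subr0 ?normr0 ?ltW//; exact: L1_continuous.
have xT' : 0 <= x <= T by case/andP: xT => ? ?; rewrite !ltW.
rewrite (prim_FTC dG cg xT') /G mulr0 subr0.
have c1 : `|c * x| <= e / 4%:R + e / 4%:R.
  rewrite /c mulrAC -mulrA normrM -[leRHS]mulr1 ler_pM//.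
    by rewrite (le_trans (ler_normB _ _))// lerD.
  case/andP: xT' => x0 xT'; rewrite ger0_norm ?divr_ge0//; last exact: ltW.
  by rewrite ler_pdivrMr// mul1r.
have Fx := Fphi x xT'.
have -> : phi x - (F x - c * x - F 0) = - (F x - phi x) + c * x + F 0 by ring.
rewrite (le_trans (ler_normD _ _))//.
have := ler_normD (- (F x - phi x)) (c * x); rewrite normrN.
move: Fx c1 F0; rewrite (_ : e = e / 4%:R * 4%:R); last by rewrite divfK// pnatr_eq0.
move: (e / 4%:R) `|_ + _| `|F x - phi x| `|c * x| `|F 0| => e4 p q r s.
rewrite mulfK ?pnatr_eq0//; lra.
Qed.

(** Such a form is a distributional derivative of the zero function. Integration by parts then kills
    it on every primitive of a continuous function of mean zero, and these are dense in C_0. *)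
Lemma Mspace_eq0 m : Mspace T m -> (forall phi, test_function T phi -> m phi = 0) ->
  forall phi, C0 T phi -> m phi = 0.
Proof.
move=> Mm m0 phi cphi.
have D0 : is_distributional_derivative T (fun=> 0) m.
  move=> psi tpsi; rewrite m0// (@eq_Int _ _ _ (fun=> 0)); last by move=> x _; rewrite mul0r.
  by rewrite Int_cst// mul0r oppr0.
have mprim g : continuous g -> Int g = 0 -> m (prim g) = 0.
  move=> cg g0; rewrite (distributional_ibp T0 (L1_cst T 0) Mm D0)//; last 2 first.
  - exact: L1_continuous.
  - apply: (L1_eq (u := fun=> 0)); last exact: L1_cst.
    by move=> x _; rewrite mul0r.
  rewrite (@eq_Int _ _ _ (fun=> 0)); last by move=> x _; rewrite mul0r.
  by rewrite Int_cst// mul0r oppr0.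
apply/eqP; rewrite -normr_le0; apply/ler_addgt0Pr => e e0; rewrite add0r.
have N1 : 0 < normM T m + 1 by rewrite ltr_wpDl// normM_ge0.
have [g [cg g0 gphi]] := prim_dense cphi (divr_gt0 e0 N1).
have cprim : C0 T (prim g) by apply: C0_prim => //; exact: L1_continuous.
rewrite (_ : m phi = m (fun x => phi x - prim g x)); last by rewrite (MspaceB Mm)// mprim// subr0.
rewrite (le_trans (ler_normMM T0 Mm (C0B cphi cprim) gphi))//.
rewrite mulrA ler_pdivrMr// mulrC ler_wpM2l ?(ltW e0)//; lra.
Qed.

Lemma distributional_derivative_unique u m1 m2 : Mspace T m1 -> Mspace T m2 ->
  is_distributional_derivative T u m1 -> is_distributional_derivative T u m2 ->
  forall phi, C0 T phi -> m1 phi = m2 phi.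
Proof.
move=> M1 M2 D1 D2 phi cphi.
have M12 := Mspace_lin T0 (-1) M2 M1.
have := Mspace_eq0 M12 _ cphi => H; apply/eqP.
rewrite -subr_eq0 -H.
  by apply/eqP; ring.
by move=> psi tpsi; rewrite D1// D2//; ring.
Qed.

(** The constant is the mean of [u]. Integrating by parts against the indicator of E minus its mean
    shows that [u] and this constant have the same integral over every measurable E, hence agree
    a.e. *)
Lemma du_Bois_Reymond u m : L1 T u -> is_distributional_derivative T u m ->
  (forall phi, C0 T phi -> m phi = 0) -> exists c : R, ae_eq0T T u (fun=> c).
Proof.
move=> iu Du m0.
have Du0 : is_distributional_derivative T u (fun=> 0).
  by move=> phi tphi; rewrite -Du// m0//; exact: C0_test_function.
pose c := Int u / T; exists c.
have mD : measurable D by exact: measurable_itv.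
suff : ae_eq leb D (EFin \o u) (EFin \o cst c).
  by apply: filterS => x /= H xT; apply: EFin_inj; apply: H; rewrite in_itv.
apply: integral_ae_eq => //; first exact/measurable_EFinP.
move=> E ED mE.
have iE : L1 T (\1_E) by exact: L1_indic.
have iuE : L1 T (fun x => u x * \1_E x).
  apply: (@L1M _ _ u (\1_E) 1) => //.
  by move=> s _; rewrite indicE; case: (_ \in _); rewrite ?normr1 ?normr0.
pose g x := \1_E x - Int (\1_E) / T * 1.
have := distributional_ibp T0 iu (Mspace_cst0 T) Du0 (g := g).
have ig : L1 T g by apply: L1B => //; apply: L1Z; exact: L1_cst.
have iug : L1 T (fun x => u x * g x).
  apply: (L1_eq (u := fun x => u x * \1_E x - Int (\1_E) / T * u x)); last exact/L1B/L1Z.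
  by move=> x _; rewrite /g; ring.
have g0 : Int g = 0.
  rewrite IntB//; last by apply: L1Z; exact: L1_cst.
  rewrite (IntZ _ (L1_cst T 1)) Int_cst// mul1r divfK ?subrr// gt_eqF//.
move=> /(_ ig iug g0) /esym/eqP; rewrite oppr_eq0 => /eqP.
rewrite (@eq_Int _ _ _ (fun x => u x * \1_E x - Int (\1_E) / T * u x)); last first.
  by move=> x _; rewrite /g; ring.
rewrite IntB//; last exact: L1Z.
rewrite IntZ// => /eqP; rewrite subr_eq0 => /eqP Eu.
have EI h : L1 T h -> (\int[leb]_(x in E) (EFin \o h) x)%E = (Int (fun x => h x * \1_E x))%:E.
  move=> ih; have iEh : leb.-integrable E (EFin \o h) by apply: integrableS ih.
  rewrite -[LHS]fineK; last exact: integrable_fin_num.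
  congr EFin; rewrite -[LHS]/(Rintegral leb E h) -[in LHS](setIidr ED) Rintegral_mkcondr.
  apply: eq_Rintegral => x _; rewrite /patch indicE.
  by case: (x \in E); rewrite ?mulr1 ?mulr0.
rewrite EI// EI ?Eu; last exact: L1_cst.
by rewrite IntZ// /c; congr EFin; ring.
Qed.

End density.

(** * Derivatives of the building blocks *)

Section bounded_variation.
Context {R : realType}.
Variable T : R.
Hypothesis T0 : 0 < T.
Implicit Types (u v w g h phi psi : R -> R) (m n : (R -> R) -> R).

Local Notation leb := (@lebesgue_measure R).
Local Notation D := (`]0, T[%classic : set (measurableTypeR R)).
Local Notation Int u := (Rintegral leb `]0, T[ u).

(** [Dmeas] is given by choice and cannot be computed; explicit derivatives are handled through this
    relation, and [Dmeas_unique] transfers their values on C_0. *)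
Definition has_deriv u m := [/\ L1 T u, Mspace T m & is_distributional_derivative T u m].

Lemma has_deriv_BV u m : has_deriv u m -> BV T u.
Proof. by move=> [iu Mm Du]; split => //; exists m. Qed.

Lemma has_deriv_Dmeas u : BV T u -> has_deriv u (Dmeas T u).
Proof.
move=> [iu [m Mm Du]].
have [|M1 D1] := @xgetPex _ (fun=> 0) [set mu | Mspace T mu /\ is_distributional_derivative T u mu].
  by exists m.
by split.
Qed.

Lemma Dmeas_unique u m phi : has_deriv u m -> C0 T phi -> Dmeas T u phi = m phi.
Proof.
move=> um; have [_ M1 D1] := has_deriv_Dmeas (has_deriv_BV um).
have [_ M2 D2] := um; exact: (distributional_derivative_unique T0 M1 M2 D1 D2).
Qed.

Lemma has_deriv_eq u v m : (forall x, D x -> u x = v x) -> has_deriv u m -> has_deriv v m.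
Proof.
move=> uv [iu Mm Du]; split => //; first exact: L1_eq uv iu.
by move=> phi tphi; rewrite Du//; congr (- _); apply: eq_Int => x Dx; rewrite uv.
Qed.

Lemma has_deriv_ext u m n : (forall phi, C0 T phi -> m phi = n phi) ->
  has_deriv u m -> has_deriv u n.
Proof.
move=> mn [iu Mm Du]; split => //; first exact: Mspace_ext mn Mm.
by move=> phi tphi; rewrite -mn ?Du//; exact: C0_test_function.
Qed.

Lemma test_function_is_derive phi (x : R) : test_function T phi ->
  is_derive x (1 : R) phi (derive1 phi x).
Proof. by move=> [/(_ 0%N) d _]; rewrite derive1E; exact/derivableP. Qed.

Lemma test_function_derive1 phi : test_function T phi -> test_function T (derive1 phi).
Proof.
move=> [d [a [b [a0 bT ab]]]]; split; first by move=> n x; rewrite -derive1Sn; exact: d.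
exists a, b; split => // x xab.
have near0 : \forall y \near x, cst 0 y = phi y.
  move: xab; rewrite negb_and -!ltNge => /orP[h|h].
    by near=> y; rewrite ab// negb_and -ltNge; apply/orP; left; near: y; exact: lt_nbhsl.
  by near=> y; rewrite ab// negb_and -!ltNge; apply/orP; right; near: y; exact: lt_nbhsr.
have [_] := near_eq_is_derive near0 (is_derive_cst (0 : R) x (1 : R)).
by rewrite derive1E.
Unshelve. all: by end_near. Qed.

Lemma L1M_derive1 u phi : L1 T u -> test_function T phi ->
  L1 T (fun x => u x * derive1 phi x).
Proof. by move=> iu tphi; apply: L1M_C0 => //; exact/C0_test_function/test_function_derive1. Qed.

Lemma has_deriv_lin (a : R) u v m n : has_deriv u m -> has_deriv v n ->
  has_deriv (fun x => a * u x + v x) (fun phi => a * m phi + n phi).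
Proof.
move=> [iu Mm Du] [iv Mn Dv]; split.
- exact/L1D/iv/L1Z.
- exact: Mspace_lin.
- move=> phi tphi; rewrite Du// Dv// mulrN -opprD; congr (- _).
  rewrite -IntZ; last exact: L1M_derive1.
  rewrite -IntD; [|exact/L1Z/L1M_derive1|exact: L1M_derive1].
  by apply: eq_Int => x _; rewrite mulrDl mulrA.
Qed.

Lemma has_deriv_cst (c : R) : has_deriv (fun=> c) (fun=> 0).
Proof.
split; [exact: L1_cst|exact: Mspace_cst0|move=> phi tphi].
have t0 x := test_function_out (x := x) tphi.
have dphi x : is_derive x (1 : R) (fun y => c * phi y) (c * derive1 phi x).
  have dp := test_function_is_derive x tphi.
  exact: is_derive_eq.
rewrite (Rintegral_FTC T0 dphi); last first.
  move=> x; apply: cvgM; [exact: cvg_cst|exact: (test_function_derive1_continuous tphi)].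
by rewrite !t0 ?ltxx ?andbF// mulr0 subrr oppr0.
Qed.

Lemma has_deriv_sum (I : finType) (c : I -> R) (u : I -> R -> R) (m : I -> (R -> R) -> R) :
  (forall i, has_deriv (u i) (m i)) ->
  has_deriv (fun x => \sum_i c i * u i x) (fun phi => \sum_i c i * m i phi).
Proof.
move=> H; elim: (index_enum I) => [|i s ih].
  under eq_fun do rewrite big_nil; under [X in has_deriv _ X]eq_fun do rewrite big_nil.
  exact: has_deriv_cst.
under eq_fun do rewrite big_cons; under [X in has_deriv _ X]eq_fun do rewrite big_cons.
exact: has_deriv_lin.
Qed.

Lemma density_lin (a : R) w v phi : L1 T w -> L1 T v -> C0 T phi ->
  density T (fun x => a * w x + v x) phi = a * density T w phi + density T v phi.
Proof.
move=> iw iv cphi; rewrite /density -IntZ; last exact: L1M_C0.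
rewrite -IntD; [|exact/L1Z/L1M_C0|exact: L1M_C0].
by apply: eq_Int => x _; ring.
Qed.

Lemma density_sum (I : finType) (c : I -> R) (w : I -> R -> R) phi :
  (forall i, L1 T (w i)) -> C0 T phi ->
  density T (fun x => \sum_i c i * w i x) phi = \sum_i c i * density T (w i) phi.
Proof.
move=> H cphi.
suff : L1 T (fun x => \sum_(i <- index_enum I) c i * w i x) /\
  density T (fun x => \sum_(i <- index_enum I) c i * w i x) phi =
    \sum_(i <- index_enum I) c i * density T (w i) phi by case.
elim: (index_enum I) => [|i s [ih1 ih2]].
  under eq_fun do rewrite big_nil; rewrite big_nil; split; first exact: L1_cst.
  by rewrite /density (@eq_Int _ _ _ (fun=> 0)) ?Int_cst ?mul0r// => x _; rewrite mul0r.
under eq_fun do rewrite big_cons; rewrite big_cons density_lin// ih2; split => //.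
exact/L1D/ih1/L1Z.
Qed.

Lemma eq_density v w phi : (forall x, D x -> v x = w x) -> density T v phi = density T w phi.
Proof. by move=> vw; apply: eq_Int => x Dx; rewrite vw. Qed.

Lemma Int_Sfun (x0 : R) f : 0 < x0 < T ->
  Int (fun x => Sfun T x0 x * f x) = \int[leb]_(x in `]x0, T[) f x.
Proof.
move=> /andP[x00 x0T].
have DE : D `&` `]x0, T[ = `]x0, T[%classic.
  apply/seteqP; split=> x /=; rewrite !in_itv/=; first by case.
  by move=> /andP[x0x xT]; rewrite xT x0x (lt_trans x00 x0x).
rewrite -[in RHS]DE Rintegral_mkcondr; apply: eq_Rintegral => x _.
by rewrite /Sfun indicE /patch; case: ifPn => _; rewrite ?mul1r ?mul0r.
Qed.

Lemma L1_Sfun (x0 : R) : L1 T (Sfun T x0).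
Proof. by apply: L1_indic; exact: measurable_itv. Qed.

Lemma has_deriv_Sfun (x0 : R) : 0 < x0 < T -> has_deriv (Sfun T x0) (fun phi => phi x0).
Proof.
move=> x0T; split; [exact: L1_Sfun|exact: Mspace_dirac|move=> phi tphi].
rewrite Int_Sfun// (Rintegral_FTC _ (fun x => test_function_is_derive x tphi)).
- by rewrite (test_function_out tphi (x := T)) ?ltxx ?andbF// sub0r opprK.
- by case/andP : x0T.
- exact: (test_function_derive1_continuous tphi).
Qed.

(** Used with a = c = x1 for kinks and with a = c = 0 for the identity; the boundary terms vanish in
    both cases. *)
Lemma Rintegral_affine_by_parts (a b c : R) phi : a < b -> test_function T phi ->
  \int[leb]_(x in `]a, b[) ((x - c) * derive1 phi x) =
  (b - c) * phi b - (a - c) * phi a - \int[leb]_(x in `]a, b[) phi x.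
Proof.
move=> ab tphi.
have cphi := test_function_continuous tphi.
have cd := test_function_derive1_continuous tphi.
have dF (x : R) : is_derive x (1 : R) (fun x => (x - c) * phi x) ((x - c) * derive1 phi x + phi x).
  have dp := test_function_is_derive x tphi.
  by apply: is_derive_eq; rewrite /GRing.scale/= subr0 mulr1.
have c1 : continuous (fun x => (x - c) * derive1 phi x).
  by move=> x; apply: cvgM; [apply: cvgB; [exact: cvg_id|exact: cvg_cst]|exact: cd].
rewrite -(Rintegral_FTC ab dF); last by move=> x; apply: cvgD; [exact: c1|exact: cphi].
by rewrite RintegralD ?addrK//; exact: integrable_oo_continuous.
Qed.

(** The kink that vanishes on the left, wherever x1 lies. For x1 < T/2, K is this function minus the
    affine function x - x1 on ]0, T[. *)
Definition Kplus (x1 x : R) : R := Sfun T x1 x * (x - x1).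

Lemma L1_Kplus (x1 : R) : 0 < x1 < T -> L1 T (Kplus x1).
Proof.
move=> x1T; apply: (@L1M _ _ (Sfun T x1) (fun x => x - x1) (T + T)).
- exact: L1_Sfun.
- exact: measurable_funB.
- move=> x; rewrite /= in_itv/= => /andP[x0 xT]; rewrite ler_norml; case/andP : x1T => ? ?.
  apply/andP; split; lra.
Qed.

Lemma has_deriv_Kplus (x1 : R) : 0 < x1 < T -> has_deriv (Kplus x1) (density T (Sfun T x1)).
Proof.
move=> x1T; split; [exact: L1_Kplus|exact/Mspace_density/L1_Sfun|move=> phi tphi].
have cphi := C0_test_function tphi.
rewrite /density Int_Sfun// (@eq_Int _ _ _ (fun x =>
    Sfun T x1 x * ((x - x1) * derive1 phi x))); last first.
  by move=> x _; rewrite /Kplus mulrA.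
rewrite Int_Sfun//.
have /andP[x10 x1lT] := x1T.
rewrite Rintegral_affine_by_parts// (test_function_out tphi (x := T)) ?ltxx ?andbF//.
ring.
Qed.

Lemma has_deriv_id : has_deriv id (density T (fun=> 1)).
Proof.
split.
- by apply: L1_continuous => // x; exact: cvg_id.
- exact/Mspace_density/L1_cst.
- move=> phi tphi.
  have := Rintegral_affine_by_parts 0 T0 tphi.
  rewrite !(test_function_out tphi) ?ltxx ?andbF// => E.
  rewrite (@eq_Int _ _ _ (fun x => (x - 0) * derive1 phi x)); last by move=> x _; rewrite subr0.
  rewrite E /density (@eq_Int _ _ _ phi); first ring.
  by move=> x _; rewrite mul1r.
Qed.

Lemma dKfunE (x1 : R) :
  dKfun T x1 = if x1 < T / 2 then (fun x => Sfun T x1 x - 1) else Sfun T x1.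
Proof. by apply/funext => x; rewrite /dKfun; case: ifP. Qed.

Lemma KfunE (x1 : R) :
  Kfun T x1 = if x1 < T / 2 then (fun x => \1_(`]0, x1[) x * (x1 - x)) else Kplus x1.
Proof. by apply/funext => x; rewrite /Kfun; case: ifP. Qed.

Lemma has_deriv_dKfun (x1 : R) : 0 < x1 < T -> has_deriv (dKfun T x1) (fun phi => phi x1).
Proof.
move=> x1T; rewrite dKfunE; case: ifP => _; last exact: has_deriv_Sfun.
apply: (has_deriv_ext (m := fun phi => -1 * 0 + phi x1)); first by move=> phi _; ring.
apply: (has_deriv_eq (u := fun x => -1 * 1 + Sfun T x1 x)); first by move=> x _; ring.
apply: has_deriv_lin; [exact: has_deriv_cst|exact: has_deriv_Sfun].
Qed.

Lemma has_deriv_Kfun (x1 : R) : 0 < x1 < T -> has_deriv (Kfun T x1) (density T (dKfun T x1)).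
Proof.
move=> x1T; rewrite dKfunE KfunE; case: ifP => _; last exact: has_deriv_Kplus.
have H := has_deriv_lin (-1) has_deriv_id (has_deriv_lin 1 (has_deriv_cst x1) (has_deriv_Kplus
    x1T)).
apply: (has_deriv_eq (u := fun x => -1 * x + (1 * x1 + Kplus x1 x))).
  move=> x; rewrite /= in_itv/= => /andP[x0 xT]; rewrite /Kplus /Sfun !indicE.
  have [xx1|xx1|->] := ltgtP x x1.
  - rewrite memNset/= ?in_itv/= ?(ltNge x1) ?(ltW xx1)//.
    by rewrite mem_set/= ?in_itv/= ?x0 ?xx1//; ring.
  - rewrite mem_set/= ?in_itv/= ?xx1 ?xT//.
    by rewrite memNset/= ?in_itv/= ?(ltNge x) ?(ltW xx1) ?andbF//; ring.
  - by rewrite !memNset/= ?in_itv/= ?ltxx ?andbF//; ring.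
apply: has_deriv_ext H => phi cphi.
rewrite mulr0 add0r -density_lin//; [|exact: L1_cst|exact: L1_Sfun].
by apply: eq_density => x _; ring.
Qed.

Variables (alpha beta : R).
Hypotheses (alpha0 : 0 <= alpha) (beta0 : 0 <= beta).

Lemma normM_Dmeas u w m n : has_deriv u m -> has_deriv w n ->
  TGV_functional T alpha beta u w =
    alpha * normM T (fun phi => m phi - density T w phi) + beta * normM T n.
Proof.
move=> um wn; rewrite /TGV_functional; congr (_ * _ + _ * _); apply: normM_ext => phi cphi.
  by rewrite /= (Dmeas_unique um).
by rewrite (Dmeas_unique wn).
Qed.

Lemma Mspace_diff_density m w : Mspace T m -> L1 T w ->
  Mspace T (fun phi => m phi - density T w phi).
Proof.
move=> Mm iw; apply: (Mspace_ext (m1 := fun phi => -1 * density T w phi + m phi)).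
  by move=> phi _; ring.
exact/Mspace_lin/Mm/Mspace_density.
Qed.

Lemma TGV_le u w m n : has_deriv u m -> has_deriv w n ->
  TGV T alpha beta u <= alpha * normM T (fun phi => m phi - density T w phi) + beta * normM T n.
Proof.
move=> um wn; rewrite -(normM_Dmeas um wn); apply: ge_inf; last first.
  by exists w => //; exact: has_deriv_BV wn.
(* An [inf] is below the elements of its set only if that set is bounded below, here by 0 since both
   norms are nonnegative. *)
exists 0 => _ [v /has_deriv_Dmeas [iv Mv Dv] <-].
have [_ Mu _] := has_deriv_Dmeas (has_deriv_BV um).
by rewrite addr_ge0// mulr_ge0// normM_ge0//; exact: Mspace_diff_density.
Qed.

End bounded_variation.

(** * Forms attaining their norm *)

Section extremal_measure.
Context {R : realType}.
Variable T : R.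
Hypothesis T0 : 0 < T.
Implicit Types (phi psi p : R -> R) (m : (R -> R) -> R).

Lemma finite_pos_lower_bound (I : finType) (f : I -> R) : (forall i, 0 < f i) ->
  exists2 d : R, 0 < d & forall i, d <= f i.
Proof.
move=> f0; exists (\big[Num.min/1]_i f i).
  by elim/big_ind : _ => // x y x0 y0; rewrite lt_min x0.
by move=> i; exact: bigmin_le_cond.
Qed.

Definition tent (d x y : R) : R := Num.max 0 (1 - `|y - x| / d).

Lemma tent_center d x : tent d x x = 1.
Proof. by rewrite /tent subrr normr0 mul0r subr0 max_r. Qed.

Lemma tent_out d x y : 0 < d -> d <= `|y - x| -> tent d x y = 0.
Proof. by move=> d0 H; rewrite /tent max_l// subr_le0 ler_pdivlMr// mul1r. Qed.

Lemma tent_bound d x y : 0 < d -> `|tent d x y| <= 1.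
Proof.
move=> d0; rewrite /tent ger0_norm ?le_max ?lexx// ge_max ler01/= gerDl oppr_le0.
by rewrite divr_ge0// ltW.
Qed.

Lemma C0_tent d x : 0 < d -> d <= x -> d <= T - x -> C0 T (tent d x).
Proof.
move=> d0 dx dT; split.
  move=> y; apply: (@continuous_max _ _ (fun=> 0) (fun y => 1 - `|y - x| / d));
      first exact: cvg_cst.
  apply: cvgB; first exact: cvg_cst.
  apply: cvgM; last exact: cvg_cst.
  by apply: cvg_norm; apply: cvgB; [exact: cvg_id|exact: cvg_cst].
move=> y; rewrite negb_and -!leNgt => /orP[] yT; apply: tent_out => //.
  by rewrite distrC ger0_norm ?subr_ge0; lra.
by rewrite ger0_norm ?subr_ge0; lra.
Qed.

Variables (m : (R -> R) -> R) (p : R -> R) (al : R).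
Hypotheses (al0 : 0 < al) (Mm : Mspace T m) (cp : C0 T p) (pal : forall y, `|p y| <= al).
Hypothesis mp : m p = al * normM T m.

(* [threshold e phi] is within [e] of [phi] and is supported where [|phi| > e], a set on
   which [al - |p|] is bounded away from zero if [phi] vanishes where [|p| = al]. *)
Let threshold (e : R) phi y := phi y - Num.max (- e) (Num.min e (phi y)).

Let C0_threshold (e : R) phi : 0 < e -> C0 T phi -> C0 T (threshold e phi).
Proof.
move=> e0 [cphi phi0]; split.
  move=> y; apply: cvgB; first exact: cphi.
  apply: (@continuous_max _ _ (fun=> - e) (fun y => Num.min e (phi y))); first exact: cvg_cst.
  by apply: (@continuous_min _ _ (fun=> e) phi); [exact: cvg_cst|exact: cphi].
move=> y yT; rewrite /threshold phi0// min_r ?(ltW e0)// max_r ?subrr// oppr_le0 ltW//.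
Qed.

Let thresholdP (e : R) phi y : 0 < e -> [/\ `|phi y - threshold e phi y| <= e,
  `|threshold e phi y| <= `|phi y| & `|phi y| <= e -> threshold e phi y = 0].
Proof.
move=> e0; rewrite /threshold.
set c := Num.max _ _; have E : phi y - (phi y - c) = c by ring.
rewrite E /c {E c}.
have [h|h] := leP (phi y) (- e).
  rewrite min_r; last lra.
  rewrite max_l//; split.
  - by rewrite normrN ger0_norm// ltW.
  - rewrite !ler0_norm; lra.
  - by rewrite ler0_norm; lra.
have [h'|h'] := leP (phi y) e.
  rewrite max_r ?(ltW h)// subrr normr0; split => //.
  by rewrite ler_norml h' ltW.
rewrite max_r; last lra.
split.
- by rewrite ger0_norm// ltW.
- rewrite !ger0_norm; lra.
- by rewrite ger0_norm; lra.
Qed.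

(** Both p + s psi and p - s psi stay in the ball of radius [al], on which [m] is largest at [p]; so
    neither s m(psi) nor its opposite is positive. *)
Let orthogonal psi (s : R) : 0 < s -> C0 T psi -> (forall y, s * `|psi y| <= al - `|p y|) ->
  m psi = 0.
Proof.
move=> s0 cpsi H.
have N phi : C0 T phi -> (forall y, `|phi y| <= al) -> m phi <= m p.
  move=> cphi phial; rewrite mp mulrC (le_trans (ler_norm _))//.
  exact: ler_normMM.
have A (e : R) : `|e| = s -> e * m psi <= 0.
  move=> es.
  have := N (fun y => p y + e * psi y) (C0D cp (C0Z e cpsi)).
  rewrite (MspaceD Mm cp (C0Z e cpsi)) (MspaceZ Mm e cpsi) gerDl; apply => y.
  rewrite (le_trans (ler_normD _ _))// normrM es; have := H y; lra.
have := A s; have := A (- s);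
    rewrite normrN gtr0_norm// mulNr oppr_le0 => /(_ erefl) h1 /(_ erefl) h2.
have /eqP : s * m psi = 0 by apply/eqP; rewrite eq_le h1 h2.
by rewrite mulf_eq0 gt_eqF//= => /eqP.
Qed.

Let vanishing phi : C0 T phi -> (forall y, 0 < y < T -> `|p y| = al -> phi y = 0) -> m phi = 0.
Proof.
move=> cphi phi0.
apply/eqP; rewrite -normr_le0; apply/ler_addgt0Pr => e' e'0; rewrite add0r.
have N1 : 0 < normM T m + 1 by rewrite ltr_wpDl// normM_ge0.
pose e := e' / (normM T m + 1).
have e0 : 0 < e by rewrite divr_gt0.
(* [F] is positive everywhere, because [phi] vanishes where |p| = al, and equals al - |p| where
   |phi| > e. Its minimum over [0, T] therefore bounds al - |p| from below on the support of the
   thresholded function. *)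
pose F y := Num.max (al - `|p y|) (e - `|phi y|).
have cabs (h : R -> R) (a y : R) : continuous h -> a - `|h z| @[z --> y] --> a - `|h y|.
  by move=> ch; apply: cvgB; [exact: cvg_cst|apply: cvg_norm; exact: ch].
have cF : continuous F.
  move=> y; apply: (@continuous_max _ _ (fun y => al - `|p y|) (fun y => e - `|phi y|)).
    exact: cabs cp.1.
  exact: cabs cphi.1.
have [y0 _ Hy0] := EVT_min (ltW T0) (continuous_subspaceT cF).
have F0 y : 0 < F y.
  rewrite /F lt_max; have [pyal|pyal] := eqVneq `|p y| al.
    apply/orP; right; have [yT|yT] := boolP (0 < y < T).
      by rewrite phi0// normr0 subr0.
    by rewrite cphi.2// normr0 subr0.
  by apply/orP; left; rewrite subr_gt0 lt_neqAle pyal pal.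
have [M M0 HM] := C0_bounded T0 cphi.
pose s := F y0 / (M + 1).
have M1 : 0 < M + 1 by rewrite ltr_wpDl.
have s0 : 0 < s by rewrite divr_gt0.
have cpsi := C0_threshold e0 cphi.
have psi0 : m (threshold e phi) = 0.
  apply: (orthogonal s0 cpsi) => y.
  have [_ h1 h2] := thresholdP phi y e0.
  have [/h2 ->|phie] := leP `|phi y| e; first by rewrite normr0 mulr0 subr_ge0.
  have yT : 0 < y < T.
    by apply: contraLR phie => yT; rewrite cphi.2// normr0 -leNgt ltW.
  have yD : y \in `[0, T] by rewrite in_itv/=; case/andP : yT => ? ?; rewrite !ltW.
  have FE : F y = al - `|p y|.
    by rewrite /F max_l// (@le_trans _ _ 0) ?subr_ge0// subr_le0 ltW.
  rewrite -FE (le_trans _ (Hy0 y yD))// /s mulrAC ler_pdivrMr// ler_wpM2l ?(ltW (F0 _))//.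
  by rewrite (le_trans h1)// (le_trans (HM y))// lerDl.
rewrite (_ : m phi = m (fun y => phi y - threshold e phi y)); last first.
  by rewrite (MspaceB Mm)// psi0 subr0.
have := ler_normMM T0 Mm (C0B cphi cpsi) (fun y => let: And3 h _ _ := thresholdP phi y e0 in h).
move=> /le_trans; apply; rewrite /e mulrA ler_pdivrMr// mulrC ler_wpM2l ?(ltW e'0)//; lra.
Qed.

Variables (N : nat) (x : 'I_N -> R).
Hypothesis xE : [set y | 0 < y < T /\ (p y = al \/ p y = - al)] = range x.

Let xT j : 0 < x j < T.
Proof. have : range x (x j) by exists j. by rewrite -xE => -[]. Qed.

(* The enumeration [x] may repeat points: the mass at a point goes to one index. *)
Let rep j := odflt j [pick i | x i == x j].

Let x_rep j : x (rep j) = x j.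
Proof. by rewrite /rep; case: pickP => [i /eqP|]. Qed.

Let rep_eq i j : x i = x j -> rep i = rep j.
Proof.
move=> xij; rewrite /rep xij; case: pickP => //= /(_ j).
by rewrite eqxx.
Qed.

Let canon j := rep j == j.

Let canon_rep j : canon (rep j).
Proof. by apply/eqP; apply: rep_eq; exact: x_rep. Qed.

Let canon_inj i j : canon i -> canon j -> x i = x j -> i = j.
Proof. by move=> /eqP ci /eqP cj /rep_eq; rewrite ci cj. Qed.

(** The radius is at most half of each distance between distinct points and at most the distance of
    each point to the boundary. The value 1 taken by [f] on equal points is only a positive
    filler. *)
Let tents : exists2 d : R, 0 < d & (forall j, C0 T (tent d (x j))) /\
  (forall i j y, canon i -> canon j -> i != j -> `|y - x i| < d -> tent d (x j) y = 0).
Proof.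
pose f (ij : 'I_N * 'I_N) : R := if x ij.1 == x ij.2 then 1 else `|x ij.1 - x ij.2| / 2%:R.
have [d1 d10 H1] : exists2 d : R, 0 < d & forall ij, d <= f ij.
  apply: finite_pos_lower_bound => ij; rewrite /f; case: eqP => // /eqP xij.
  by rewrite divr_gt0// normr_gt0 subr_eq0.
have [d2 d20 H2] : exists2 d : R, 0 < d & forall i, d <= Num.min (x i) (T - x i).
  apply: finite_pos_lower_bound => i; have /andP[? ?] := xT i.
  by rewrite lt_min subr_gt0; apply/andP.
have d0 : 0 < Num.min d1 d2 by rewrite lt_min d10.
have dd1 : Num.min d1 d2 <= d1 by rewrite ge_min lexx.
have dd2 : Num.min d1 d2 <= d2 by rewrite ge_min lexx orbT.
exists (Num.min d1 d2) => //; split.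
  move=> j; have := H2 j; rewrite le_min => /andP[? ?].
  by apply: C0_tent => //; exact: le_trans dd2 _.
move=> i j y ci cj ij yi; apply: tent_out => //.
have := H1 (i, j); rewrite /f/=; case: eqP => [/(canon_inj ci cj) /eqP|_];
    first by rewrite (negbTE ij).
rewrite ler_pdivlMr// => H.
have := ler_distD y (x i) (x j); rewrite (distrC (x i) y) => H3.
move: yi dd1 H H3; move: (Num.min d1 d2) `|y - x i| `|y - x j| `|x i - x j| => a b c e; lra.
Qed.

(** Subtracting from [phi] its interpolation by tents leaves a function that vanishes on the contact
    set, which [m] annihilates; so the mass at a point is the value of [m] on its tent. *)
Lemma extremal_measure : exists c : 'I_N -> R,
  [/\ forall phi, C0 T phi -> m phi = \sum_j c j * phi (x j),
      forall j, c j * p (x j) = al * `|c j| & normM T m = \sum_j `|c j|].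
Proof.
have [d d0 [cten dten]] := tents.
have ten_other i j : canon j -> rep i != j -> tent d (x j) (x i) = 0.
  move=> cj ij; apply: (dten (rep i) j) => //.
  by rewrite x_rep subrr normr0.
pose c j := if canon j then m (tent d (x j)) else 0.
have mc phi : C0 T phi -> m phi = \sum_j c j * phi (x j).
  move=> cphi; pose b j := if canon j then phi (x j) else 0.
  have cS := C0_sum (T := T) b cten.
  have : m (fun y => phi y - \sum_j b j * tent d (x j) y) = 0.
    apply: vanishing; first exact: C0B.
    move=> y yT pyal; have [i xi] : exists i, y = x i.
      have : range x y.
        rewrite -xE; split => //; move: pyal; case: ger0P => _ <-; first by left.
        by right; rewrite opprK.
      by case=> i _ <-; exists i.
    rewrite xi (bigD1 (rep i))//= big1 ?addr0.
      by rewrite /b canon_rep -x_rep tent_center mulr1 subrr.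
    move=> j ji; rewrite /b; case: ifPn => cj; last by rewrite mul0r.
    by rewrite ten_other ?mulr0// eq_sym.
  rewrite (MspaceB Mm)// (Mspace_sum Mm)// => /eqP; rewrite subr_eq0 => /eqP ->.
  apply: eq_bigr => j _; rewrite /b /c; case: ifP; rewrite ?mul0r// mulrC//.
have n1 : normM T m <= \sum_j `|c j|.
  apply: normM_le => // phi cphi phi1; rewrite mc// (le_trans (ler_norm_sum _ _ _))//.
  by apply: ler_sum => j _; rewrite normrM ler_piMr.
have n2 : \sum_j `|c j| <= normM T m.
  (* The tents with nonzero coefficients do not overlap, so this signed combination is bounded by 1,
     and [m] takes the value sum of |c j| on it. *)
  pose b j := if canon j then Num.sg (c j) else 0.
  have cS := C0_sum (T := T) b cten.
  rewrite (_ : \sum_j _ = m (fun y => \sum_j b j * tent d (x j) y)); last first.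
    rewrite (Mspace_sum Mm)//; apply: eq_bigr => j _; rewrite /b; case: ifPn => cj.
      by rewrite normrEsg {2}/c cj.
    by rewrite /c (negbTE cj) normr0 mul0r.
  rewrite (le_trans (ler_norm _))//; apply: ler_normM => // y.
  have [[i ci yi]|H] := pselect (exists2 i, canon i & `|y - x i| < d).
    rewrite (bigD1 i)//= big1 ?addr0.
      rewrite normrM mulr_ile1// ?tent_bound// /b ci normr_sg; case: eqP => //.
    move=> j ji; rewrite /b; case: ifPn => cj; last by rewrite mul0r.
    by rewrite (dten i j)// ?mulr0// eq_sym.
  rewrite big1 ?normr0// => j _; rewrite /b; case: ifPn => cj; last by rewrite mul0r.
  rewrite tent_out ?mulr0// leNgt; apply/negP => yj; apply: H; exists j => //.
have nE : normM T m = \sum_j `|c j| by apply/eqP; rewrite eq_le n1 n2.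
exists c; split => // j.
(* Every term is nonnegative as |p| <= al, so each of them vanishes. *)
have : \sum_j (al * `|c j| - c j * p (x j)) = 0.
  by rewrite sumrB -mulr_sumr -mc// mp nE subrr.
move=> /eqP; rewrite psumr_eq0.
  by move=> /allP/(_ j (mem_index_enum _)); rewrite subr_eq0 => /eqP.
move=> i _; rewrite subr_ge0 (le_trans (ler_norm _))// normrM mulrC ler_wpM2r//.
Qed.

End extremal_measure.

(** * First-order optimality *)

Section L2_space.
Context {R : realType}.
Variable T : R.
Hypothesis T0 : 0 < T.
Implicit Types (u v w g h phi psi : R -> R) (m n : (R -> R) -> R).

Local Notation leb := (@lebesgue_measure R).
Local Notation D := (`]0, T[%classic : set (measurableTypeR R)).
Local Notation Int u := (Rintegral leb `]0, T[ u).

Lemma L2_bounded u (C : R) : measurable_fun D u -> (forall x, D x -> `|u x| <= C) -> L2 T u.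
Proof.
move=> mu uC.
have mD : measurable D by exact: measurable_itv.
have mr : measurable_fun setT (u \_ D) by apply/(measurable_restrictT _ _).1.
rewrite /L2 inE; apply/andP; split; first by rewrite inE.
rewrite inE/= /finite_norm unlock /Lnorm poweR_lty//.
have iu2 : L1 T (fun x => u x * u x).
  have iu := L1_bounded mu uC; exact: L1M iu mu uC.
rewrite (eq_integral (EFin \o ((fun x => u x * u x) \_ D))).
  exact/integrable_lty/L1_restrict.
move=> x _; rewrite /= powR_mulrn// real_normK ?num_real//; congr EFin.
by rewrite /patch; case: ifP => _; rewrite expr2 ?mulr0.
Qed.

Lemma L2_lin (a : R) u v : L2 T u -> L2 T v -> L2 T (fun x => a * u x + v x).
Proof.
rewrite /L2 => Lu Lv.
have [_ H] := @Lfun_submod_closed _ _ R leb 2%:E (lee1n 2).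
rewrite (_ : (fun x => a * u x + v x) \_ D = a *: (u \_ D) + v \_ D); first exact: H.
apply/funext => x.
rewrite -[RHS]/(a * (u \_ D) x + (v \_ D) x) /patch.
by case: ifP; rewrite // mulr0 addr0.
Qed.

Lemma L2Z (a : R) u : L2 T u -> L2 T (fun x => a * u x).
Proof.
move=> Lu; have L0 : L2 T (fun=> 0) by apply: (@L2_bounded _ 0) => // x _; rewrite normr0.
have := L2_lin a Lu L0; congr (L2 T _); apply/funext => x; exact: addr0.
Qed.

Lemma normL2Z (a : R) u : L2 T u -> normL2 T (fun x => a * u x) = `|a| * normL2 T u.
Proof.
move=> Lu; rewrite /normL2.
have := @LnormZ _ _ R leb 2%:E (lee1n 2) (Lfun_Sub (lee1n 2) Lu) a.
rewrite /= => E.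
have -> : ((fun x => a * u x) \_ D) = a \*: (u \_ D).
  by apply/funext => x; rewrite /patch /=; case: ifP; rewrite ?mulr0// scaler0.
rewrite E fineM//.
have := @Lfunction_finite _ _ _ leb 2%:E (lee1n 2) (Lfun_Sub (lee1n 2) Lu).
by rewrite /finite_norm ge0_fin_numE ?Lnorm_ge0.
Qed.

Lemma L2M u v : L2 T u -> L2 T v -> L1 T (fun x => u x * v x).
Proof.
move=> Lu Lv; have /Lfun1_integrable := Lfun2_mul_Lfun1 Lu Lv.
have mD : measurable D by exact: measurable_itv.
rewrite (_ : EFin \o _ = (EFin \o (fun x => u x * v x)) \_ D); last first.
  by apply/funext => x; rewrite /patch /=; case: ifP; rewrite ?mul0r.
by rewrite -integrable_mkcond.
Qed.

Lemma L2_L1 u : L2 T u -> L1 T u.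
Proof.
move=> Lu.
have L1' : L2 T (fun=> 1) by apply: (@L2_bounded _ `|1|).
by apply: L1_eq (L2M Lu L1') => x _; rewrite mulr1.
Qed.

Lemma normL2_ge0 u : 0 <= normL2 T u.
Proof. by rewrite /normL2 fine_ge0// Lnorm_ge0. Qed.

Lemma L2_continuous f : continuous f -> L2 T f.
Proof.
move=> cf.
have [c _ Hc] : exists2 c, c \in `[0, T] & forall t, t \in `[0, T] -> `|f t| <= `|f c|.
  apply: (@EVT_max _ (fun x => `|f x|)); first exact: ltW.
  by apply: continuous_subspaceT => x; apply: cvg_norm; exact: cf.
apply: (@L2_bounded _ `|f c|).
  by apply: measurable_funTS; exact: continuous_measurable_fun.
by move=> x; rewrite /= in_itv/= => /andP[x0 xT]; apply: Hc; rewrite in_itv/= !ltW.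
Qed.

(** Here C bounds the slope of TGV along the direction. The restriction t < 1 keeps the factor 1 + t
    s nonnegative when s = -1 and the direction is [ubar] itself. *)
Lemma first_order (f : (R -> R) -> R) u A v (C : R) :
  is_frechet_derivative T f u A -> L2 T v ->
  (forall t : R, 0 < t < 1 -> f u <= f (u \+ (fun x => t * v x)) + t * C) ->
  0 <= A v + C.
Proof.
move=> [Lu [lin _] fre] Lv H.
have L0 : L2 T (fun=> 0) by apply: (@L2_bounded _ 0) => // x _; rewrite normr0.
have A0 : A (fun=> 0) = 0.
  have := lin 1 _ _ L0 L0; rewrite (_ : (fun x : R => 1 * 0 + 0) = (fun=> 0)); first lra.
  by apply/funext => x; rewrite mulr0 addr0.
have AZ (t : R) : A (fun x => t * v x) = t * A v.
  rewrite -[RHS]addr0 -A0 -lin//; congr A; apply/funext => x; rewrite addr0//.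
have N0 := normL2_ge0 v.
apply/ler_addgt0Pr => e' e'0.
have N1 : 0 < normL2 T v + 1 by rewrite ltr_wpDl.
pose e := e' / (normL2 T v + 1).
have e0 : 0 < e by rewrite divr_gt0.
have [d d0 Hd] := fre e e0.
(* Small enough for t < 1 and t |v| < d, the halves making both strict; adding 1 to the norm covers
   a direction of norm zero. *)
pose t := Num.min (2%:R^-1) (d / (normL2 T v + 1) / 2%:R).
have q0 : 0 < d / (normL2 T v + 1) by rewrite divr_gt0.
have t0 : 0 < t by rewrite lt_min invr_gt0 ltr0n/= divr_gt0.
have t1 : t < 1 by rewrite gt_min invf_lt1 ?ltr1n ?ltr0n.
have tN : t * normL2 T v < d.
  have tq : t < d / (normL2 T v + 1).
    by rewrite gt_min orbC ltr_pdivrMr// ltr_pMr// ltr1n.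
  rewrite (le_lt_trans (y := t * (normL2 T v + 1)))//; last by rewrite -ltr_pdivlMr.
  by rewrite ler_wpM2l ?(ltW t0)// lerDl.
have nt : normL2 T (fun x => t * v x) = t * normL2 T v by rewrite normL2Z// gtr0_norm.
have := Hd (fun x => t * v x) (L2Z t Lv); rewrite nt => /(_ tN).
have := H t; rewrite t0 t1 => /(_ isT).
rewrite AZ ler_norml => h1 /andP[h2 h3].
have eN : e * normL2 T v <= e'.
  by rewrite /e mulrAC ler_pdivrMr// ler_wpM2l ?(ltW e'0)// lerDl.
have arith (a b c k N : R) : a <= b + t * k -> b - a - t * c <= e * (t * N) ->
    0 <= t * (c + k + e * N).
  have -> : t * (c + k + e * N) = t * c + t * k + e * (t * N) by ring.
  lra.
have := arith _ _ _ _ _ h1 h3; rewrite pmulr_rge0//; lra.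
Qed.

Lemma normM_lin (a : R) m n : Mspace T m -> Mspace T n ->
  normM T (fun phi => a * m phi + n phi) <= `|a| * normM T m + normM T n.
Proof.
move=> Mm Mn; apply: normM_le => //; first exact: Mspace_lin.
move=> phi cphi phi1.
rewrite (le_trans (ler_normD _ _))// normrM lerD//.
  by rewrite ler_wpM2l// ler_normM.
exact: ler_normM.
Qed.

End L2_space.

(** * Variations of the pair [(ubar, wbar)] *)

Section variations.
Context {R : realType}.
Variables (T alpha beta : R).
Hypotheses (T0 : 0 < T) (alpha0 : 0 < alpha) (beta0 : 0 < beta).
Variables (f : (R -> R) -> R) (ubar wbar g : R -> R).
Hypotheses (ubar_BV : BV T ubar) (wbar_BV : BV T wbar).
Hypothesis ubar_min : forall u, BV T u ->
  f ubar + TGV T alpha beta ubar <= f u + TGV T alpha beta u.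
Hypothesis wbar_opt : TGV T alpha beta ubar =
  alpha * normM T (Dmeas T ubar \- density T wbar) + beta * normM T (Dmeas T wbar).
Hypothesis g_grad : is_gradient T f ubar g.

Local Notation leb := (@lebesgue_measure R).
Local Notation Int u := (Rintegral leb `]0, T[ u).
Local Notation Du := (Dmeas T ubar).
Local Notation Dw := (Dmeas T wbar).
Let mu phi := Du phi - density T wbar phi.

Let hu : has_deriv T ubar Du. Proof. exact: has_deriv_Dmeas. Qed.
Let hw : has_deriv T wbar Dw. Proof. exact: has_deriv_Dmeas. Qed.
Let Mmu : Mspace T mu.
Proof. by case: hu hw => _ M1 _ [iw _ _]; exact: Mspace_diff_density. Qed.
Let TGVE : TGV T alpha beta ubar = alpha * normM T mu + beta * normM T Dw.
Proof. exact: wbar_opt. Qed.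

Let LU : L2 T ubar. Proof. by case: g_grad => _ [A []]. Qed.

Let TGV_path (t : R) v m w n : has_deriv T v m -> has_deriv T w n ->
  TGV T alpha beta (ubar \+ (fun x => t * v x)) <=
  alpha * normM T (fun phi => t * (m phi - density T w phi) + mu phi) +
  beta * normM T (fun phi => t * n phi + Dw phi).
Proof.
move=> hv hwn.
have h1 : has_deriv T (ubar \+ (fun x => t * v x)) (fun phi => t * m phi + Du phi).
  by apply: has_deriv_eq (has_deriv_lin T0 t hv hu) => x _; rewrite /= addrC.
have h2 := has_deriv_lin T0 t hwn hw.
apply: le_trans (TGV_le T0 (ltW alpha0) (ltW beta0) h1 h2) _.
rewrite lerD2r ler_wpM2l ?(ltW alpha0)//.
case: hwn hw => iw _ _ [iwb _ _].
rewrite (@normM_ext _ T _ (fun phi => t * (m phi - density T w phi) + mu phi))// => phi cphi.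
rewrite density_lin// /mu; ring.
Qed.

Lemma gradient_bound v m w n : has_deriv T v m -> has_deriv T w n -> L2 T v ->
  `|Int (fun x => g x * v x)| <=
  alpha * normM T (fun phi => m phi - density T w phi) + beta * normM T n.
Proof.
move=> hv hwn Lv; have [_ [A fA AE]] := g_grad.
set C := alpha * _ + _.
(* The signs s = 1 and s = -1 give the two halves of the absolute value, with the same constant C
   since norms are even. *)
have H (s t : R) : `|s| = 1 -> 0 < t < 1 ->
    f ubar <= f (ubar \+ (fun x => t * (s * v x))) + t * C.
  move=> s1 /andP[t0 _].
  have E : ubar \+ (fun x => t * (s * v x)) = ubar \+ (fun x => (t * s) * v x).
    by apply/funext => x /=; rewrite mulrA.
  rewrite E.
  have B : BV T (ubar \+ (fun x => (t * s) * v x)).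
    apply: (has_deriv_BV (m := fun phi => (t * s) * m phi + Du phi)).
    by apply: has_deriv_eq (has_deriv_lin T0 (t * s) hv hu) => x _; rewrite /= addrC.
  have := ubar_min B; have := TGV_path (t * s) hv hwn.
  case: hv hwn => iv Mm _ [iw Mn _]; case: hw => _ MDw _.
  have := normM_lin T0 (t * s) (Mspace_diff_density T0 Mm iw) Mmu.
  have := normM_lin T0 (t * s) Mn MDw.
  rewrite normrM s1 mulr1 (gtr0_norm t0) TGVE /C.
  move=> h1 h2; have := ler_wpM2l (ltW alpha0) h2; have := ler_wpM2l (ltW beta0) h1.
  move: (normM T _) (normM T _) (normM T _) (normM T _) (normM T _) (normM T _) =>
      a1 a2 a3 a4 a5 a6.
  move: (TGV _ _ _ _) (f _) (f _) => a7 a8 a9 b1 b2 b3 b4.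
  have -> : t * (alpha * a2 + beta * a5) = alpha * (t * a2) + beta * (t * a5) by ring.
  move: b1 b2; rewrite !mulrDr; lra.
have L1v : L2 T (fun x => 1 * v x) by exact: L2Z.
have LNv : L2 T (fun x => -1 * v x) by exact: L2Z.
have := first_order fA L1v (fun t => H 1 t (normr1 _)).
have := first_order fA LNv (fun t => H (-1) t (normrN1 _)).
rewrite !AE//.
have ig : L1 T (fun x => g x * v x) by apply: L2M => //; case: g_grad.
rewrite (@eq_Int _ _ _ (fun x => -1 * (g x * v x))); last by move=> x _; ring.
rewrite [X in _ -> 0 <= X + _ -> _](@eq_Int _ _ _ (fun x => 1 * (g x * v x)));
    last by move=> x _; ring.
rewrite !IntZ// mul1r mulN1r ler_norml => h1 h2; apply/andP; split; lra.
Qed.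

(** Along its own direction the pair is only rescaled by 1 + t s, so TGV varies by at most t s TGV
    with the sign of s. The two signs therefore give opposite inequalities, hence an equality. *)
Lemma gradient_ubar : Int (fun x => g x * ubar x) = - TGV T alpha beta ubar.
Proof.
have [_ [A fA AE]] := g_grad.
have H (s t : R) : `|s| = 1 -> 0 < t < 1 ->
    f ubar <= f (ubar \+ (fun x => t * (s * ubar x))) + t * (s * TGV T alpha beta ubar).
  move=> s1 /andP[t0 t1].
  have E : ubar \+ (fun x => t * (s * ubar x)) = ubar \+ (fun x => (t * s) * ubar x).
    by apply/funext => x /=; rewrite mulrA.
  rewrite E.
  have B : BV T (ubar \+ (fun x => (t * s) * ubar x)).
    apply: (has_deriv_BV (m := fun phi => (t * s) * Du phi + Du phi)).
    by apply: has_deriv_eq (has_deriv_lin T0 (t * s) hu hu) => x _; rewrite /= addrC.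
  have := ubar_min B; have := TGV_path (t * s) hu hw.
  have ts0 : 0 <= t * s + 1.
    have : `|t * s| <= 1 by rewrite normrM s1 mulr1 gtr0_norm// ltW.
    by rewrite ler_norml => /andP[? _]; lra.
  have nn m : Mspace T m -> normM T (fun phi => t * s * m phi + m phi) <= (t * s + 1) * normM T m.
    move=> Mm; apply: normM_le => //; first exact: Mspace_lin.
    move=> phi cphi phi1.
    rewrite (_ : _ + _ = (t * s + 1) * m phi); last by ring.
    by rewrite normrM (ger0_norm ts0) ler_wpM2l// ler_normM.
  have h1 := nn _ Mmu; have h2 : normM T (fun phi =>
      t * s * Dw phi + Dw phi) <= (t * s + 1) * normM T Dw.
    by apply: nn; case: hw.
  have := ler_wpM2l (ltW alpha0) h1; have := ler_wpM2l (ltW beta0) h2.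
  rewrite -/mu TGVE; move: (normM T _) (normM T _) (normM T _) (normM T _) => a1 a2 a3 a4.
  move: (TGV _ _ _ _) (f _) (f _) => a7 a8 a9 b1 b2 b3 b4.
  have -> : t * (s * (alpha * a1 + beta * a3)) =
      alpha * ((t * s + 1) * a1) + beta * ((t * s + 1) * a3) - (alpha * a1 + beta * a3) by ring.
  lra.
have L1v : L2 T (fun x => 1 * ubar x) by exact: L2Z.
have LNv : L2 T (fun x => -1 * ubar x) by exact: L2Z.
have := first_order fA L1v (fun t => H 1 t (normr1 _)).
have := first_order fA LNv (fun t => H (-1) t (normrN1 _)).
rewrite !AE//.
have ig : L1 T (fun x => g x * ubar x) by apply: L2M => //; case: g_grad.
rewrite (@eq_Int _ _ _ (fun x => -1 * (g x * ubar x))); last by move=> x _; ring.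
rewrite [X in _ -> 0 <= X + _ -> _](@eq_Int _ _ _ (fun x => 1 * (g x * ubar x)));
    last by move=> x _; ring.
rewrite !IntZ// !mul1r !mulN1r => h1 h2; apply/eqP; rewrite eq_le; apply/andP; split; lra.
Qed.

End variations.

(** * Representation of the minimizer *)

Section L2_parameters.
Context {R : realType}.
Variable T : R.
Hypothesis T0 : 0 < T.

Lemma L2_Sfun (x : R) : L2 T (Sfun T x).
Proof.
apply: (@L2_bounded _ _ _ 1); first by apply: L1_measurable; exact: L1_Sfun.
by move=> s _; rewrite /Sfun indicE; case: (_ \in _); rewrite ?normr1 ?normr0.
Qed.

Lemma L2_Kfun (x : R) : 0 < x < T -> L2 T (Kfun T x).
Proof.
move=> xT; have [iK _ _] := has_deriv_Kfun T0 xT.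
apply: (@L2_bounded _ _ _ T); first exact: L1_measurable.
move=> s; rewrite /= in_itv/= => /andP[s0 sT]; case/andP : xT => x0 xT.
have B (b : bool) (y : R) : `|y| <= T -> `|b%:R * y| <= T.
  by case: b => h; rewrite ?mul1r// mul0r normr0 ltW.
by rewrite /Kfun; case: ifP => _; rewrite indicE; apply: B; rewrite ler_norml; apply/andP;
    split; lra.
Qed.

End L2_parameters.

Section optimality.
Context {R : realType}.
Variables (T alpha beta : R).
Hypotheses (T0 : 0 < T) (alpha0 : 0 < alpha) (beta0 : 0 < beta).
Variables (f : (R -> R) -> R) (ubar wbar g : R -> R).
Hypotheses (ubar_BV : BV T ubar) (wbar_BV : BV T wbar).
Hypothesis ubar_min : forall u, BV T u ->
  f ubar + TGV T alpha beta ubar <= f u + TGV T alpha beta u.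
Hypothesis wbar_opt : TGV T alpha beta ubar =
  alpha * normM T (Dmeas T ubar \- density T wbar) + beta * normM T (Dmeas T wbar).
Hypothesis g_grad : is_gradient T f ubar g.

Local Notation leb := (@lebesgue_measure R).
Local Notation D := (`]0, T[%classic : set (measurableTypeR R)).
Local Notation Int u := (Rintegral leb `]0, T[ u).
Local Notation prim := (prim T).

Let bound := gradient_bound T0 alpha0 beta0 ubar_BV wbar_BV ubar_min wbar_opt g_grad.

Let Lg2 : L2 T g. Proof. by case: g_grad. Qed.
Let Lg : L1 T g. Proof. exact: L2_L1. Qed.

Let normM0 (m : (R -> R) -> R) : (forall phi, C0 T phi -> m phi = 0) -> normM T m = 0.
Proof.
move=> m0; have M0 := Mspace_cst0 T.
rewrite (@normM_ext _ T m (fun=> 0))//; apply/eqP; rewrite eq_le normM_ge0// andbT.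
by apply: normM_le => // phi _ _; rewrite normr0.
Qed.

Let L2_cst (c : R) : L2 T (fun=> c).
Proof. by apply: (@L2_bounded _ _ _ `|c|). Qed.

Let L2_id : L2 T id.
Proof. by apply: L2_continuous => // x; exact: cvg_id. Qed.

Let normM_density_id (w : R -> R) : normM T (fun phi => density T w phi - density T w phi) = 0.
Proof. by apply: normM0 => phi _; rewrite subrr. Qed.

Let Int_g : Int g = 0.
Proof.
have := bound (has_deriv_cst T0 1) (has_deriv_cst T0 0) (L2_cst 1).
rewrite !normM0 ?mulr0 ?addr0; [|by []|]; last first.
  move=> phi _; rewrite /density (@eq_Int _ _ _ (fun=> 0)) ?Int_cst ?mul0r ?subrr//.
  by move=> x _; rewrite mul0r.
rewrite normr_le0 => /eqP; rewrite (@eq_Int _ _ _ g)// => x _; exact: mulr1.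
Qed.

Let C0p : C0 T (prim g). Proof. exact: C0_prim. Qed.

(** The pair (x, 1) has zero cost, so [g] is orthogonal to x; integrating by parts turns this moment
    into minus the mean of the primitive. *)
Let Int_p : Int (prim g) = 0.
Proof.
have := bound (has_deriv_id T0) (has_deriv_cst T0 1) L2_id.
rewrite normM_density_id normM0// !mulr0 addr0 normr_le0 => /eqP E.
have [i1 M1 D1] := has_deriv_id T0.
have ixg : L1 T (fun x => id x * g x) by exact: L2M.
have := distributional_ibp T0 i1 M1 D1 Lg ixg Int_g.
rewrite (@eq_Int _ _ _ (fun x => g x * id x)) ?E ?oppr0; last by move=> x _; rewrite mulrC.
by rewrite /density (@eq_Int _ _ _ (prim g))// => x _; rewrite mul1r.
Qed.

Let C0P : C0 T (fun x => - prim (prim g) x).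
Proof.
have c := C0_prim T0 (L1_C0 T0 C0p) Int_p.
by have := C0Z (-1) c; congr (C0 T _); apply/funext => x; rewrite mulN1r.
Qed.

Let Int_mul_Sfun (x0 : R) h : L1 T h -> Int (fun x => h x * Sfun T x0 x) = Int h - prim h x0.
Proof.
move=> ih; rewrite primE -IntB//; last exact: L1_prim_integrand.
apply: eq_Int => x; rewrite /= in_itv/= => /andP[_ xT].
rewrite /Sfun !indicE; have [xx0|x0x] := leP x x0.
  rewrite memNset ?mem_set/= ?in_itv/= ?(ltNge x0) ?xx0//; ring.
rewrite mem_set ?memNset/= ?in_itv/= ?(leNgt x) ?x0x ?xT//; ring.
Qed.

Let p_le (x : R) : `|prim g x| <= alpha.
Proof.
have [xT|xT] := boolP (0 < x < T); last by rewrite C0p.2// normr0 ltW.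
have := bound (has_deriv_Sfun T0 xT) (has_deriv_cst T0 0) (L2_Sfun T x).
rewrite Int_mul_Sfun// Int_g sub0r normrN [X in _ + _ * X]normM0// mulr0 addr0 => /le_trans; apply.
rewrite -[leRHS]mulr1 ler_wpM2l ?(ltW alpha0)//.
apply: normM_le => //.
  apply: Mspace_diff_density => //; [exact: Mspace_dirac|exact: L1_cst].
move=> phi _ phi1; rewrite /density (@eq_Int _ _ _ (fun=> 0)) ?Int_cst ?mul0r ?subr0//.
by move=> y _; rewrite mul0r.
Qed.

Let P_le (x : R) : `|- prim (prim g) x| <= beta.
Proof.
have [xT|xT] := boolP (0 < x < T); last by rewrite C0P.2// normr0 ltW.
have := bound (has_deriv_Kfun T0 xT) (has_deriv_dKfun T0 xT) (L2_Kfun T0 xT).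
rewrite normM_density_id mulr0 add0r => H.
have [i1 M1 D1] := has_deriv_Kfun T0 xT.
have iKg : L1 T (fun y => Kfun T x y * g y) by apply: L2M => //; exact: L2_Kfun.
have := distributional_ibp T0 i1 M1 D1 Lg iKg Int_g.
rewrite (@eq_Int _ _ (fun y => Kfun T x y * g y) (fun y => g y * Kfun T x y));
    last by move=> y _; rewrite mulrC.
(* K' is S or S - 1 according to the position of x; the constant has no effect since [prim g] has
   mean zero. *)
have -> : density T (dKfun T x) (prim g) = - prim (prim g) x.
  have ip := L1_C0 T0 C0p.
  have A := Int_mul_Sfun x ip.
  rewrite Int_p sub0r in A; rewrite -A /density dKfunE; case: ifP => _.
    rewrite (@eq_Int _ _ _ (fun y => prim g y * Sfun T x y - prim g y)); last by move=> y _; ring.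
    rewrite IntB// ?Int_p ?subr0//.
    apply: (L1M (C := 1)) => //; first by apply: L1_measurable; exact: L1_Sfun.
    by move=> s _; rewrite /Sfun indicE; case: (_ \in _); rewrite ?normr1 ?normr0.
  by apply: eq_Int => y _; rewrite mulrC.
move=> ->; rewrite normrN (le_trans H)// -[leRHS]mulr1 ler_wpM2l ?(ltW beta0)//.
by apply: normM_le => //; exact: Mspace_dirac.
Qed.

Local Notation Dw := (Dmeas T wbar).
Local Notation mu := (fun phi => Dmeas T ubar phi - density T wbar phi).

Let extremal : mu (prim g) = alpha * normM T mu /\
  Dw (fun x => - prim (prim g) x) = beta * normM T Dw.
Proof.
have [iu Mu Du] := has_deriv_Dmeas ubar_BV.
have [iw Mw Dw_] := has_deriv_Dmeas wbar_BV.
have Mmu : Mspace T mu by exact: Mspace_diff_density.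
have E := gradient_ubar T0 alpha0 beta0 ubar_BV wbar_BV ubar_min wbar_opt g_grad.
have Lu : L2 T ubar by case: g_grad => _ [A []].
have iug : L1 T (fun x => ubar x * g x) by exact: L2M.
have E1 := distributional_ibp T0 iu Mu Du Lg iug Int_g.
have ip := L1_C0 T0 C0p.
have E2 := distributional_ibp T0 iw Mw Dw_ ip (L1M_C0 T0 iw C0p) Int_p.
have cpp := C0_prim T0 ip Int_p.
have E3 : Dw (fun x => - prim (prim g) x) = Int (fun x => wbar x * prim g x).
  rewrite -[RHS]opprK -E2 -mulN1r -(MspaceZ Mw)//; congr Dw.
  by apply/funext => x; rewrite mulN1r.
have E4 : mu (prim g) = TGV T alpha beta ubar - Dw (fun x => - prim (prim g) x).
  rewrite E1 E3 /density -[TGV _ _ _ _]opprK -E; congr (- _ - _).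
  by apply: eq_Int => x _; rewrite mulrC.
have B1 := ler_normMM T0 Mmu C0p p_le.
have B2 := ler_normMM T0 Mw C0P P_le.
have TE : TGV T alpha beta ubar = alpha * normM T mu + beta * normM T Dw by exact: wbar_opt.
move: B1 B2; rewrite !ler_norml => /andP[_ B1] /andP[_ B2].
move: B1 B2 E4 TE; move: (mu _) (normM T mu) (Dw _) (normM T Dw) (TGV _ _ _ _) =>
    a b c d e B1 B2 E4 TE.
(* Two upper bounds whose sum is attained are both equalities. *)
split; lra.
Qed.

Variables (NS NK : nat) (xS : 'I_NS -> R) (xK : 'I_NK -> R).
Hypothesis xS_def :
  [set x | 0 < x < T /\ (pbar g x = alpha \/ pbar g x = - alpha)] = range xS.
Hypothesis xK_def :
  [set x | 0 < x < T /\ (Pbar g x = beta \/ Pbar g x = - beta)] = range xK.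

Let pbarE x : 0 < x < T -> pbar g x = prim g x.
Proof. by move=> xT; rewrite prim_pbar. Qed.

Let PbarE x : 0 < x < T -> Pbar g x = - prim (prim g) x.
Proof.
move=> xT; rewrite prim_pbar//; last exact: L1_C0.
rewrite /Pbar /pbar; congr (- _); apply: eq_Rintegral => s.
rewrite inE/= in_itv/= => /andP[s0 sx]; apply: pbarE.
by rewrite s0/= (lt_trans sx)//; case/andP : xT.
Qed.

Lemma jump_points (j : 'I_NS) : 0 < xS j < T /\ (pbar g (xS j) = alpha \/ pbar g (xS j) = - alpha).
Proof.
have : range xS (xS j) by exists j.
by rewrite -xS_def.
Qed.

Lemma kink_points (j : 'I_NK) : 0 < xK j < T /\ (Pbar g (xK j) = beta \/ Pbar g (xK j) = - beta).
Proof.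
have : range xK (xK j) by exists j.
by rewrite -xK_def.
Qed.

Lemma extremal_representation : exists (c : 'I_NS -> R) (d : 'I_NK -> R),
  [/\ forall phi, C0 T phi -> Dmeas T ubar phi = \sum_j c j * phi (xS j) + density T wbar phi,
      forall phi, C0 T phi -> Dmeas T wbar phi = \sum_j d j * phi (xK j),
      forall j, c j * pbar g (xS j) = alpha * `|c j|,
      forall j, d j * Pbar g (xK j) = beta * `|d j| &
      TGV T alpha beta ubar = alpha * \sum_j `|c j| + beta * \sum_j `|d j|].
Proof.
have [E1 E2] := extremal.
have [iu Mu Du] := has_deriv_Dmeas ubar_BV.
have [iw Mw Dw_] := has_deriv_Dmeas wbar_BV.
have Mmu : Mspace T mu by exact: Mspace_diff_density.
have xS_def' : [set x | 0 < x < T /\ (prim g x = alpha \/ prim g x = - alpha)] = range xS.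
  rewrite -xS_def; apply/seteqP; split => x /= [xT]; rewrite pbarE//.
have xK_def' : [set x | 0 < x < T /\ (- prim (prim g) x = beta \/ - prim (prim g) x =
    - beta)] = range xK.
  rewrite -xK_def; apply/seteqP; split => x /= [xT]; rewrite PbarE//.
have [c [c1 c2 c3]] := extremal_measure T0 Mmu C0p p_le E1 xS_def'.
have [d [d1 d2 d3]] := extremal_measure T0 Mw C0P P_le E2 xK_def'.
exists c, d; split.
- by move=> phi cphi; rewrite -c1// subrK.
- exact: d1.
- by move=> j; rewrite pbarE ?c2//; case: (jump_points j).
- by move=> j; rewrite PbarE ?d2//; case: (kink_points j).
- by rewrite -c3 -d3; exact: wbar_opt.
Qed.

End optimality.

(** * The family of piecewise affine candidates and the recovery of [ubar] *)

Section parametrization.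
Context {R : realType}.
Variables (T : R) (NS NK : nat) (xS : 'I_NS -> R) (xK : 'I_NK -> R).
Hypotheses (T0 : 0 < T) (xST : forall j, 0 < xS j < T) (xKT : forall j, 0 < xK j < T).

Local Notation leb := (@lebesgue_measure R).
Local Notation D := (`]0, T[%classic : set (measurableTypeR R)).
Local Notation Int u := (Rintegral leb `]0, T[ u).

Definition w_lin (d : 'I_NK -> R) (a x : R) : R := \sum_j d j * dKfun T (xK j) x + a.

(** The family of the theorem with each product of sign, weight and 1/alpha or 1/beta merged into
    one real coefficient. *)
Definition u_lin (c : 'I_NS -> R) (d : 'I_NK -> R) (a b x : R) : R :=
  \sum_j c j * Sfun T (xS j) x + \sum_j d j * Kfun T (xK j) x + a * x + b.

Lemma has_deriv_w_lin d a : has_deriv T (w_lin d a) (fun phi => \sum_j d j * phi (xK j)).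
Proof.
have H := has_deriv_lin T0 1 (has_deriv_sum T0 d (fun j =>
    has_deriv_dKfun T0 (xKT j))) (has_deriv_cst T0 a).
apply: has_deriv_eq (has_deriv_ext _ H) => [x _|phi _]; first by rewrite /w_lin mul1r.
by rewrite mul1r addr0.
Qed.

Lemma has_deriv_u_lin c d a b : has_deriv T (u_lin c d a b)
  (fun phi => \sum_j c j * phi (xS j) + density T (w_lin d a) phi).
Proof.
have HS := has_deriv_sum T0 c (fun j => has_deriv_Sfun T0 (xST j)).
have HK := has_deriv_sum T0 d (fun j => has_deriv_Kfun T0 (xKT j)).
have Ha := has_deriv_lin T0 a (has_deriv_id T0) (has_deriv_cst T0 b).
have H := has_deriv_lin T0 1 HS (has_deriv_lin T0 1 HK Ha).
apply: has_deriv_eq (has_deriv_ext _ H) => [x _|phi cphi]; first by rewrite /u_lin; ring.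
have id_ j : L1 T (dKfun T (xK j)) by case: (has_deriv_dKfun T0 (xKT j)).
have iS : L1 T (fun x => \sum_j d j * dKfun T (xK j) x).
  by case: (has_deriv_sum T0 d (fun j => has_deriv_dKfun T0 (xKT j))).
rewrite !mul1r addr0; congr (_ + _).
rewrite -(density_sum T0)// addrC -density_lin//; last exact: L1_cst.
by apply: eq_density => x _; rewrite /w_lin mulr1 addrC.
Qed.

Lemma L2_u_lin c d a b : L2 T (u_lin c d a b).
Proof.
have L0 : L2 T (fun=> 0) by apply: (@L2_bounded _ _ _ 0) => // x _; rewrite normr0.
have Lsum (n : nat) (e : 'I_n -> R) (h : 'I_n -> R -> R) : (forall j, L2 T (h j)) ->
    L2 T (fun x => \sum_j e j * h j x).
  move=> Lh; elim: (index_enum _) => [|i s ih].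
    by under eq_fun do rewrite big_nil.
  by under eq_fun do rewrite big_cons; exact: L2_lin.
have A1 := Lsum _ c _ (fun j => L2_Sfun T (xS j)).
have A2 := Lsum _ d _ (fun j => L2_Kfun T0 (xKT j)).
have A3 : L2 T (fun x => a * x + b).
  apply: (L2_lin a (u := id)); first by apply: L2_continuous => // x; exact: cvg_id.
  by apply: (@L2_bounded _ _ _ `|b|).
have := L2_lin 1 A1 (L2_lin 1 A2 A3); congr (L2 T _); apply/funext => x.
by rewrite /u_lin; ring.
Qed.

(** With [w_lin d a] as competitor, both forms in the functional are combinations of Dirac masses,
    whose norms are at most the sums of the absolute coefficients. *)
Lemma TGV_u_lin (alpha beta : R) c d a b : 0 < alpha -> 0 < beta ->
  TGV T alpha beta (u_lin c d a b) <= alpha * \sum_j `|c j| + beta * \sum_j `|d j|.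
Proof.
move=> alpha0 beta0.
have hu := has_deriv_u_lin c d a b; have hw := has_deriv_w_lin d a.
have [iw Mw _] := hw.
apply: le_trans (TGV_le T0 (ltW alpha0) (ltW beta0) hu hw) _.
have MM := Mspace_diff_density T0 (let: And3 _ Mm _ := hu in Mm) iw.
have B (n : nat) (e : 'I_n -> R) (x : 'I_n -> R) phi : (forall y, `|phi y| <= 1) ->
    `|\sum_j e j * phi (x j)| <= \sum_j `|e j|.
  move=> phi1; rewrite (le_trans (ler_norm_sum _ _ _))//.
  by apply: ler_sum => j _; rewrite normrM ler_piMr.
apply: lerD; (apply: ler_wpM2l; first exact: ltW); apply: normM_le => //.
  by move=> phi _ phi1; rewrite addrK; exact: B.
by move=> phi _ phi1; exact: B.
Qed.

Lemma ae_eq0T_impl (u v u' v' : R -> R) :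
  (forall x, 0 < x < T -> u x = v x -> u' x = v' x) -> ae_eq0T T u v -> ae_eq0T T u' v'.
Proof.
move=> H; apply: filterS; first exact: (ae_filter_ringOfSetsType leb).
by move=> x uv xT; apply: H => //; exact: uv.
Qed.

Lemma ae_eq_density w v phi : L1 T w -> L1 T v -> C0 T phi -> ae_eq0T T w v ->
  density T w phi = density T v phi.
Proof.
move=> iw iv cphi wv; rewrite /density /Rintegral; congr fine.
apply: ae_eq_integral => //.
- by case/integrableP : (L1M_C0 T0 iw cphi).
- by case/integrableP : (L1M_C0 T0 iv cphi).
- move: wv; apply: filterS; first exact: (ae_filter_ringOfSetsType leb).
  by move=> x H; rewrite /= in_itv/= => /H ->.
Qed.

Lemma ae_eq_has_deriv u v m : has_deriv T u m -> has_deriv T v m ->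
  exists b : R, ae_eq0T T u (fun x => v x + b).
Proof.
move=> hu hv.
have [iz Mz Dz] := has_deriv_lin T0 (-1) hv hu.
have [|b Hb] := du_Bois_Reymond T0 iz Dz; first by move=> phi cphi; ring.
exists b; apply: ae_eq0T_impl Hb => x _; lra.
Qed.

(** [wbar] comes first, up to a constant [a], because its density enters the derivative of [ubar];
    then [ubar] is known up to a constant [b]. *)
Lemma ae_eq_u_lin ubar wbar c d : BV T ubar -> BV T wbar ->
  (forall phi, C0 T phi -> Dmeas T ubar phi = \sum_j c j * phi (xS j) + density T wbar phi) ->
  (forall phi, C0 T phi -> Dmeas T wbar phi = \sum_j d j * phi (xK j)) ->
  exists a b : R, ae_eq0T T ubar (u_lin c d a b) /\ ae_eq0T T wbar (w_lin d a).
Proof.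
move=> ubar_BV wbar_BV Eu Ew.
have hw : has_deriv T wbar (fun phi => \sum_j d j * phi (xK j)).
  exact: has_deriv_ext Ew (has_deriv_Dmeas wbar_BV).
have [a Ha] := ae_eq_has_deriv hw (has_deriv_w_lin d 0).
have {}Ha : ae_eq0T T wbar (w_lin d a).
  by apply: ae_eq0T_impl Ha => x _ ->; rewrite /w_lin addr0.
have [iw _ _] := hw; have [iwl _ _] := has_deriv_w_lin d a.
have hu : has_deriv T ubar (fun phi => \sum_j c j * phi (xS j) + density T (w_lin d a) phi).
  apply: has_deriv_ext (has_deriv_Dmeas ubar_BV) => phi cphi.
  by rewrite Eu// (ae_eq_density iw iwl cphi Ha).
have [b Hb] := ae_eq_has_deriv hu (has_deriv_u_lin c d a 0).
exists a, b; split => //.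
by apply: ae_eq0T_impl Hb => x _ ->; rewrite /u_lin addr0.
Qed.

End parametrization.

(** The last hypothesis says that [c] has the sign of [p], so the weight al |c| and the sign p / al
    recover it. *)
Lemma signed_weight (F : realFieldType) (c p al : F) : 0 < al -> p = al \/ p = - al ->
  c * p = al * `|c| -> al^-1 * (p / al * (al * `|c|)) = c.
Proof.
move=> al0 pal cp; have aln0 : al != 0 by rewrite gt_eqF.
rewrite -cp; case: pal => ->; field; exact: aln0.
Qed.

Lemma norm_signed_weight (F : realFieldType) (l p al : F) : 0 < al -> p = al \/ p = - al ->
  0 <= l -> al * `|al^-1 * (p / al * l)| = l.
Proof.
move=> al0 pal l0; have aln0 : al != 0 by rewrite gt_eqF.
have E : `|p / al| = 1.
  by case: pal => ->; rewrite ?mulNr ?normrN divff// normr1.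
rewrite normrM normrM E mul1r (ger0_norm l0) ger0_norm ?invr_ge0 ?ltW//.
by rewrite mulrA divff// mul1r.
Qed.

Theorem theorem5 (R : realType) (T alpha beta : R)
  (T_gt0 : 0 < T) (alpha_gt0 : 0 < alpha) (beta_gt0 : 0 < beta)
  (f : (R -> R) -> R)
  (f_wd : well_defined_on_L2 T f) (f_diff : frechet_differentiable T f)
  (ubar : R -> R) (ubar_BV : BV T ubar)
  (ubar_min : forall u, BV T u ->
     f ubar + TGV T alpha beta ubar <= f u + TGV T alpha beta u)
  (wbar : R -> R) (wbar_BV : BV T wbar)
  (wbar_opt : TGV T alpha beta ubar =
     alpha * normM T (Dmeas T ubar \- density T wbar) + beta * normM T (Dmeas T wbar))
  (g : R -> R) (g_grad : is_gradient T f ubar g)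
  (NS NK : nat) (xS : 'I_NS -> R) (xK : 'I_NK -> R)
  (xS_def : [set x | 0 < x < T /\ (pbar g x = alpha \/ pbar g x = - alpha)]
            = range xS)
  (xK_def : [set x | 0 < x < T /\ (Pbar g x = beta \/ Pbar g x = - beta)]
            = range xK) :
  let sS := fun j => pbar g (xS j) / alpha in
  let sK := fun j => Pbar g (xK j) / beta in
  let u_ := u_param T alpha beta xS sS xK sK in
  let objective := fun lS lK a b =>
    f (u_ lS lK a b) + \sum_(j < NS) lS j + \sum_(j < NK) lK j in
  exists (lS : 'I_NS -> R) (lK : 'I_NK -> R) (a b : R),
    [/\ [/\ forall j, 0 <= lS j,
            forall j, 0 <= lK j &
            forall (lS' : 'I_NS -> R) (lK' : 'I_NK -> R) (a' b' : R),
              (forall j, 0 <= lS' j) -> (forall j, 0 <= lK' j) ->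
              objective lS lK a b <= objective lS' lK' a' b'],
        ae_eq0T T ubar (u_ lS lK a b),
        ae_eq0T T wbar (w_param T beta xK sK lK a) &
        TGV T alpha beta ubar = \sum_(j < NS) lS j + \sum_(j < NK) lK j].
Proof.
move=> sS sK u_ objective.
have xST j := (jump_points xS_def j).1; have pS j := (jump_points xS_def j).2.
have xKT j := (kink_points xK_def j).1; have pK j := (kink_points xK_def j).2.
have [c [d [Eu Ew cp dP TGVE]]] := extremal_representation T_gt0 alpha_gt0 beta_gt0
  ubar_BV wbar_BV ubar_min wbar_opt g_grad xS_def xK_def.
have [a [b [ubarE wbarE]]] := ae_eq_u_lin T_gt0 xST xKT ubar_BV wbar_BV Eu Ew.
have u_E lS lK a' b' : u_ lS lK a' b' =
    u_lin T xS xK (fun j => alpha^-1 * (sS j * lS j)) (fun j => beta^-1 * (sK j * lK j)) a' b'.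
  apply/funext => x; rewrite /u_ /u_param /u_lin !mulr_sumr.
  by congr (_ + _ + _ + _); apply: eq_bigr => j _; rewrite !mulrA.
have cE : (fun j => alpha^-1 * (sS j * (alpha * `|c j|))) = c.
  by apply/funext => j; rewrite /sS signed_weight.
have dE : (fun j => beta^-1 * (sK j * (beta * `|d j|))) = d.
  by apply/funext => j; rewrite /sK signed_weight.
(* The cost of each atom is its weight, so that the weights add up to TGV(ubar). *)
pose lS j := alpha * `|c j|; pose lK j := beta * `|d j|.
have uE : u_ lS lK a b = u_lin T xS xK c d a b by rewrite u_E cE dE.
have TGVl : TGV T alpha beta ubar = \sum_(j < NS) lS j + \sum_(j < NK) lK j.
  by rewrite TGVE -!mulr_sumr.
exists lS, lK, a, b; split => //; last 2 first.
- by rewrite uE.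
- apply: ae_eq0T_impl wbarE => x _ ->.
  rewrite /w_lin /w_param mulr_sumr; congr (_ + _); apply: eq_bigr => j _.
  by rewrite -[in LHS]dE !mulrA.
split=> [j|j|lS' lK' a' b' lS'0 lK'0]; [by rewrite mulr_ge0// ltW|by rewrite mulr_ge0// ltW|].
(* Square integrability of both functions allows [f] to be transferred along the a.e. equality. *)
have Lubar : L2 T ubar by case: g_grad => _ [A []].
have fE : f (u_ lS lK a b) = f ubar.
  rewrite uE; symmetry; apply: f_wd => //; exact: L2_u_lin.
rewrite /objective fE -addrA -TGVl -addrA.
have BV' : BV T (u_ lS' lK' a' b').
  by rewrite u_E; exact: has_deriv_BV (has_deriv_u_lin T_gt0 xST xKT _ _ _ _).
(* It remains to bound TGV of the competitor by the sum of its weights; nonnegativity is what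
   identifies alpha or beta times an absolute coefficient with its weight. *)
apply: le_trans (ubar_min _ BV') _; rewrite lerD2l u_E.
apply: le_trans (TGV_u_lin T_gt0 xST xKT _ _ _ _ alpha_gt0 beta_gt0) _.
rewrite !mulr_sumr; apply: lerD; apply: ler_sum => j _.
  by rewrite norm_signed_weight.
by rewrite norm_signed_weight.
Qed.
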